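(* Let $(\Omega,\mu)$ be an atomless finite measure space and let $p(\cdot)$ be an exponent on $\Omega$. The following are equivalent: (1) The inclusion $L^\infty(\mu)\hookrightarrow L^{p(\cdot)}(\mu)$ is strictly singular. (2) $p(\cdot)\in L^{exp}_0(\mu)$. (3) $\lim_{x\to 0}\dfrac{\int_0^x p^*(s)\,ds}{x\ln\left(\frac{e}{x}\right)}=0$ (limit as $x\to0^+$). (4) $\lim_{x\to\mu(\Omega)^-}(\mu(\Omega)-x)^{\left(\frac1p\right)^*(x)}=0$.
   Context: An exponent on $\Omega$ is a real measurable function $p$ with $1\le p(t)<\infty$ (possibly unbounded). The variable Lebesgue space $L^{p(\cdot)}(\mu)$ is the space of all (classes of) real measurable $f$ on $\Omega$ such that $\rho_{p(\cdot)}(f/r)<\infty$ for some $r>0$, where $\rho_{p(\cdot)}(f)=\int_\Omega |f(t)|^{p(t)}d\mu$, with the Luxemburg norm $\|f\|_{p(\cdot)}=\inf\{r>0:\rho_{p(\cdot)}(f/r)\le 1\}$. On a finite measure space $L^\infty(\mu)\subset L^{p(\cdot)}(\mu)$ with continuous inclusion. $L^{exp}_0(\mu)$ is the space of all measurable functions $f$ on $\Omega$ such that $\int_\Omega e^{|rf(t)|}d\mu<\infty$ for every $r>0$. For measurable $f$ on $\Omega$, the distribution function is $\mu_f(s)=\mu(\{t\in\Omega:|f(t)|>s\})$ and the decreasing rearrangement is $f^*(x)=\inf\{s\in[0,\infty):\mu_f(s)\le x\}$ for $x\in[0,\mu(\Omega))$. An operator between Banach spaces $T:E\to F$ is strictly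 singular if there is no infinite-dimensional closed subspace $E_1$ of $E$ such that the restriction $T|_{E_1}$ is an isomorphism onto its image. *)

(* Defs.v *)
From HB Require Import structures.
From mathcomp Require Import all_boot all_order all_algebra.
From mathcomp Require Import all_classical all_reals all_analysis.
From mathcomp Require Import measurable_realfun ess_sup_inf.

Set Implicit Arguments.
Unset Strict Implicit.
Unset Printing Implicit Defensive.
Import Order.TTheory GRing.Theory Num.Theory.
Import numFieldNormedType.Exports.
Local Open Scope classical_set_scope.
Local Open Scope ring_scope.
Local Open Scope quotient_scope.

Definition linear_subspace (R : numFieldType) (E : lmodType R)
    (V : set E) : Prop :=
  V 0 /\ forall (a : R) x y, V x -> V y -> V (a *: x + y).

Definition finite_dimensional (R : numFieldType) (E : lmodType R)
    (V : set E) : Prop :=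
  exists (n : nat) (e : 'I_n -> E),
    V = [set \sum_(i < n) c i *: e i | c in [set: 'I_n -> R]].

(* [f] restricted to [V] is a homeomorphism onto its image; being linear, it is
   then an isomorphism of normed spaces. *)
Definition isomorphism_on (R : numFieldType) (E F : normedModType R)
    (V : set E) (f : {linear E -> F}) : Prop :=
  {within V, continuous f} /\
  exists g : F -> E,
    {within f @` V, continuous g} /\ (forall x, V x -> g (f x) = x).

Definition strictly_singular (R : numFieldType) (E F : normedModType R)
    (f : {linear E -> F}) : Prop :=
  ~ exists V : set E,
      [/\ linear_subspace V, closed V, ~ finite_dimensional V
        & isomorphism_on V f].

Section measurable_classes.
Context d (T : measurableType d) (R : realType).
Variable mu : {measure set T -> \bar R}.
Local Notation L0 := {mfun_ mu, T >-> R}.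
Implicit Types f g h : L0.

(* The quotient type [L0] carries no algebraic structure in the library: it is
   made a real vector space here, with the operations of representatives. *)
Definition L0_class (u : {mfun T >-> R}) : L0 := \pi u.

Definition L0_zero : L0 := L0_class (0 : {mfun T >-> R}%type).
Definition L0_add f g : L0 := L0_class (repr f + repr g).
Definition L0_opp f : L0 := L0_class (- repr f).
Definition L0_scale (a : R) f : L0 := L0_class (a *: repr f).

Lemma L0_classE (u : {mfun T >-> R}) : L0_class u = u %[ae mu].
Proof.
by apply/asboolP; rewrite -/(ae_eq_op mu _ u) -eqmodE /L0_class reprK.
Qed.

Lemma eq_L0P f g : f = g :> L0 <-> (f : T -> R) = g %[ae mu].
Proof.
split=> [->|fg]; first exact: ae_eq_refl.
by rewrite -[f]reprK -[g]reprK; apply/eqP; rewrite eqmodE; apply/asboolP.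
Qed.

Let addE f g : (L0_add f g : T -> R) = f \+ g %[ae mu].
Proof. exact: L0_classE. Qed.

Let oppE f : (L0_opp f : T -> R) = \- f %[ae mu].
Proof. exact: L0_classE. Qed.

Let scaleE a f : (L0_scale a f : T -> R) = a \*: f %[ae mu].
Proof. exact: L0_classE. Qed.

Let zeroE : (L0_zero : T -> R) = cst 0 %[ae mu].
Proof. exact: L0_classE. Qed.

Let L0_addA : associative L0_add.
Proof.
move=> f g h; apply/eq_L0P; near=> x => _.
rewrite (near (addE f (L0_add g h)) x)//= (near (addE g h) x)//=.
by rewrite (near (addE (L0_add f g) h) x)//= (near (addE f g) x)//= addrA.
Unshelve. all: by end_near. Qed.

Let L0_addC : commutative L0_add.
Proof. by move=> f g; rewrite /L0_add addrC. Qed.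

Let L0_add0 : left_id L0_zero L0_add.
Proof.
move=> f; apply/eq_L0P; near=> x => _.
by rewrite (near (addE L0_zero f) x)//= (near zeroE x)//= add0r.
Unshelve. all: by end_near. Qed.

Let L0_addN : left_inverse L0_zero L0_opp L0_add.
Proof.
move=> f; apply/eq_L0P; near=> x => _.
rewrite (near (addE (L0_opp f) f) x)//= (near (oppE f) x)//=.
by rewrite (near zeroE x)//= addNr.
Unshelve. all: by end_near. Qed.

HB.instance Definition _ :=
  GRing.isZmodule.Build L0 L0_addA L0_addC L0_add0 L0_addN.

Let L0_scaleA a b f : L0_scale a (L0_scale b f) = L0_scale (a * b) f.
Proof.
apply/eq_L0P; near=> x => _.
rewrite (near (scaleE a (L0_scale b f)) x)//= (near (scaleE b f) x)//=.
by rewrite (near (scaleE (a * b) f) x)//= scalerA.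
Unshelve. all: by end_near. Qed.

Let L0_scale1 : left_id 1 L0_scale.
Proof.
move=> f; apply/eq_L0P; near=> x => _.
by rewrite (near (scaleE 1 f) x)//= scale1r.
Unshelve. all: by end_near. Qed.

Let L0_scaleDr : right_distributive L0_scale +%R.
Proof.
move=> a f g; apply/eq_L0P; near=> x => _.
rewrite (near (scaleE a (f + g)) x)//= (near (addE f g) x)//=.
rewrite (near (addE (L0_scale a f) (L0_scale a g)) x)//=.
by rewrite (near (scaleE a f) x)//= (near (scaleE a g) x)//= scalerDr.
Unshelve. all: by end_near. Qed.

Let L0_scaleDl f : {morph L0_scale^~ f : a b / a + b}.
Proof.
move=> a b; apply/eq_L0P; near=> x => _.
rewrite (near (scaleE (a + b) f) x)//=.
rewrite (near (addE (L0_scale a f) (L0_scale b f)) x)//=.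
by rewrite (near (scaleE a f) x)//= (near (scaleE b f) x)//= scalerDl.
Unshelve. all: by end_near. Qed.

HB.instance Definition _ := GRing.Zmodule_isLmodule.Build R L0
  L0_scaleA L0_scale1 L0_scaleDr L0_scaleDl.

Lemma L0_zeroE : ((0 : L0) : T -> R) = cst 0 %[ae mu].
Proof. exact: zeroE. Qed.

Lemma L0_addE f g : ((f + g : L0) : T -> R) = f \+ g %[ae mu].
Proof. exact: addE. Qed.

Lemma L0_scaleE a f : ((a *: f : L0) : T -> R) = a \*: f %[ae mu].
Proof. exact: scaleE. Qed.

End measurable_classes.

Section essentially_bounded_classes.
Context d (T : measurableType d) (R : realType).
Variable mu : {measure set T -> \bar R}.
Local Notation L0 := {mfun_ mu, T >-> R}.

Definition Linfty_pred : {pred L0} := mem [set f : L0 | finite_norm mu +oo f].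

Record Linfty := LinftyOf { Linfty_val :> L0; _ : Linfty_val \in Linfty_pred }.

HB.instance Definition _ := [isSub for Linfty_val].
HB.instance Definition _ := [Choice of Linfty by <:].

Local Notation Ninfty f := (Lnorm mu +oo%E (EFin \o f)).

Lemma Linfty_Lnorm_ae (f g : T -> R) : f = g %[ae mu] -> Ninfty f = Ninfty g.
Proof.
move=> fg; rewrite unlock /Lnorm; case: ifPn => // _; apply: eq_ess_sup.
by apply: filterS fg => x /= ->.
Qed.

Lemma Linfty_Lnorm0 : Ninfty (@cst T R 0) = 0%E. Proof. exact: Lnorm0. Qed.

Lemma Linfty_LnormD (f g : L0) : (Ninfty (f + g : L0)%R <= Ninfty f + Ninfty g)%E.
Proof.
by rewrite (Linfty_Lnorm_ae (L0_addE f g)) eminkowski ?leey.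
Qed.

Lemma Linfty_LnormZ (a : R) (f : L0) : (Ninfty (a *: f : L0)%R = `|a|%:E * Ninfty f)%E.
Proof.
rewrite (Linfty_Lnorm_ae (L0_scaleE a f)) unlock /Lnorm.
case: ifPn => mu0; last by rewrite mule0.
rewrite -ess_supZl//; apply: eq_ess_sup; apply: nearW => t /=.
by rewrite normrZ EFinM.
Qed.

Let Linfty_submod_closed : submod_closed Linfty_pred.
Proof.
split; first by rewrite inE /= /finite_norm (Linfty_Lnorm_ae (L0_zeroE mu)) Linfty_Lnorm0.
move=> a f g; rewrite !inE /= /finite_norm => fy gy.
apply: (le_lt_trans (Linfty_LnormD _ _)); rewrite Linfty_LnormZ lte_add_pinfty//.
by rewrite lte_mul_pinfty// lee_fin.
Qed.

HB.instance Definition _ :=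
  GRing.isSubmodClosed.Build R L0 Linfty_pred Linfty_submod_closed.
HB.instance Definition _ := [SubChoice_isSubLmodule of Linfty by <:].

Definition Linfty_norm (f : Linfty) : R := fine (Ninfty f).

Lemma Linfty_normK (f : Linfty) : (Linfty_norm f)%:E = Ninfty f.
Proof.
rewrite /Linfty_norm fineK// ge0_fin_numE ?Lnorm_ge0//.
by case: f => f /=; rewrite inE.
Qed.

Let Linfty_normD (f g : Linfty) :
  Linfty_norm (f + g) <= Linfty_norm f + Linfty_norm g.
Proof. by rewrite -lee_fin EFinD !Linfty_normK Linfty_LnormD. Qed.

Let Linfty_normZ (a : R) (f : Linfty) :
  Linfty_norm (a *: f) = `|a| * Linfty_norm f.
Proof. by apply/EFin_inj; rewrite EFinM !Linfty_normK Linfty_LnormZ. Qed.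

Let Linfty_norm_eq0 (f : Linfty) : Linfty_norm f = 0 -> f = 0.
Proof.
move=> f0; have N0 : Ninfty f = 0%E by rewrite -Linfty_normK f0.
apply/val_inj/eq_L0P.
have mf : measurable_fun setT (EFin \o (f : T -> R)).
  exact/measurable_EFinP/(measurable_funP (repr (Linfty_val f))).
have {}f0 := Lnorm_eq0_eq0 mf (ltry 0) N0.
apply: ae_eq_trans (ae_eq_sym (L0_zeroE mu)).
by apply: filterS f0 => x /(_ I) [].
Qed.

HB.instance Definition _ := Lmodule_isNormed.Build R Linfty
  Linfty_normD Linfty_normZ Linfty_norm_eq0.

Lemma Linfty_finite (f : Linfty) : finite_norm mu +oo f.
Proof. by case: f => f /=; rewrite inE. Qed.

End essentially_bounded_classes.

Record exponent d (T : measurableType d) (R : realType) := Exponent {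
  exponent_fun :> T -> R;
  measurable_exponent : measurable_fun setT exponent_fun;
  exponent_ge1 : forall t, 1 <= exponent_fun t }.

Section variable_Lebesgue_space.
Context d (T : measurableType d) (R : realType).
Variable mu : {measure set T -> \bar R}.
Variable p : exponent T R.
Local Notation L0 := {mfun_ mu, T >-> R}.

Definition modular (f : T -> R) : \bar R :=
  (\int[mu]_t (`|f t| `^ p t)%:E)%E.

Definition luxemburg_set (f : T -> R) : set R :=
  [set r | 0 < r /\ (modular (fun t => f t / r)%R <= 1)%E].

Definition luxemburg_norm (f : T -> R) : R := inf (luxemburg_set f).

Let p_neq0 t : p t != 0.
Proof. by rewrite gt_eqF// (lt_le_trans ltr01)// exponent_ge1. Qed.

Lemma measurable_modular (f : T -> R) : measurable_fun setT f ->
  measurable_fun setT (fun t => (`|f t| `^ p t)%:E).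
Proof.
move=> mf; apply/measurable_EFinP.
rewrite (_ : (fun _ => _) =
  fun t => if f t == 0 then 0 else expR (p t * ln `|f t|)); last first.
  apply/funext => t; rewrite /powR normr_eq0; case: ifPn => // _.
  by rewrite (negPf (p_neq0 t)).
apply: measurable_fun_ifT => //.
- exact: measurable_fun_eqr.
- apply: measurableT_comp => //; apply: measurable_funM.
    exact: measurable_exponent.
  by apply: measurableT_comp => //; exact: measurableT_comp.
Qed.

Lemma modular_ge0 f : (0 <= modular f)%E.
Proof. by apply: integral_ge0 => t _; rewrite lee_fin powR_ge0. Qed.

Lemma modular_ae (f g : T -> R) : measurable_fun setT f ->
  measurable_fun setT g -> f = g %[ae mu] -> modular f = modular g.
Proof.
move=> mf mg fg; apply: ae_eq_integral => //.
- exact: measurable_modular.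
- exact: measurable_modular.
- by apply: filterS fg => t /= + _ => /(_ I) ->.
Qed.

Lemma modular0 : modular (cst 0) = 0%E.
Proof.
rewrite /modular; apply: integral0_eq => t _ /=.
by rewrite normr0 powR0.
Qed.

Lemma modular_convex (a : R) (f g : T -> R) : 0 <= a <= 1 ->
  measurable_fun setT f -> measurable_fun setT g ->
  (modular (fun t => a * f t + (1 - a) * g t)%R <=
   a%:E * modular f + (1 - a)%:E * modular g)%E.
Proof.
move=> /andP[a0 a1] mf mg.
have b0 : 0 <= 1 - a by rewrite subr_ge0.
have m0 (h : T -> R) t : (0 <= (`|h t| `^ p t)%:E)%E by rewrite lee_fin powR_ge0.
rewrite /modular -(ge0_integralZl mu measurableT (measurable_modular mf))//.
rewrite -(ge0_integralZl mu measurableT (measurable_modular mg))//.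
have mm (k : R) (h : T -> R) : measurable_fun setT h ->
    measurable_fun setT (fun t => k%:E * (`|h t| `^ p t)%:E)%E.
  by move=> mh; apply: measurable_funeM; exact: measurable_modular.
have mm0 (k : R) (h : T -> R) t : 0 <= k -> (0 <= k%:E * (`|h t| `^ p t)%:E)%E.
  by move=> k0; rewrite mule_ge0.
rewrite -(ge0_integralD mu measurableT _ (mm a _ mf) _ (mm _ _ mg)); last 2 first.
- by move=> t _; exact: mm0.
- by move=> t _; exact: mm0.
apply: ge0_le_integral => //.
- apply: measurable_modular; apply: measurable_funD; exact: measurable_funM.
- by apply: emeasurable_funD; exact: mm.
move=> t _; rewrite -!EFinM -EFinD lee_fin.
have p1 := exponent_ge1 p t.
apply: (@le_trans _ _ ((a * `|f t| + (1 - a) * `|g t|) `^ p t)).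
  apply: ge0_ler_powR; rewrite ?nnegrE//.
  - by rewrite (le_trans ler01).
  - by rewrite addr_ge0// mulr_ge0.
  - by rewrite (le_trans (ler_normD _ _))// !normrM (ger0_norm a0) (ger0_norm b0).
have a01 : (0 <= a <= 1)%R by rewrite a0.
have := @convex_powR R (p t) p1 (Itv01 a0 a1) `|f t| `|g t|.
rewrite !inE/= !in_itv/= !andbT => /(_ (normr_ge0 _) (normr_ge0 _)).
by rewrite !convRE.
Qed.

Lemma modular_scale (c : R) (f : T -> R) : 0 <= c <= 1 ->
  measurable_fun setT f ->
  (modular (fun t => c * f t)%R <= c%:E * modular f)%E.
Proof.
move=> c01 mf; have := modular_convex c01 mf (measurable_cst (0 : R)).
rewrite modular0 mule0 adde0.
suff -> : (fun t => c * f t + (1 - c) * cst 0 t) = (fun t => c * f t) by [].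
by apply/funext => t /=; rewrite mulr0 addr0.
Qed.

Definition modular_finite (f : T -> R) : Prop :=
  exists2 r : R, 0 < r & (modular (fun t => f t / r)%R < +oo)%E.

Let measurable_div (f : T -> R) (r : R) : measurable_fun setT f ->
  measurable_fun setT (fun t => f t / r).
Proof. by move=> mf; exact: measurable_funM. Qed.

Lemma luxemburg_set_has_lbound f : has_lbound (luxemburg_set f).
Proof. by exists 0 => r [/ltW]. Qed.

Lemma luxemburg_set_nonempty f : measurable_fun setT f -> modular_finite f ->
  luxemburg_set f !=set0.
Proof.
move=> mf [r r0 foo]; set m := modular _ in foo.
have mfin : m \is a fin_num by rewrite ge0_fin_numE// modular_ge0.
pose k := Num.max 1 (fine m).
have k1 : 1 <= k by rewrite le_max lexx.
have k0 : 0 < k by rewrite (lt_le_trans ltr01).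
exists (r * k); split; first by rewrite mulr_gt0.
rewrite (_ : (fun _ => _) = (fun t => k^-1 * (f t / r))); last first.
  by apply/funext => t; rewrite invfM mulrA mulrC.
apply: (le_trans (modular_scale _ (measurable_div r mf))).
  by rewrite invr_ge0 ltW//= invf_le1.
rewrite -/m -(fineK mfin) -EFinM lee_fin ler_pdivrMl// mulr1.
by rewrite le_max lexx orbT.
Qed.

Lemma luxemburg_set_has_inf f : measurable_fun setT f -> modular_finite f ->
  has_inf (luxemburg_set f).
Proof.
move=> mf ff; split; first exact: luxemburg_set_nonempty.
exact: luxemburg_set_has_lbound.
Qed.

Lemma luxemburg_norm_le f r : luxemburg_set f r -> luxemburg_norm f <= r.
Proof. by move=> fr; apply: ge_inf => //; exact: luxemburg_set_has_lbound. Qed.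

Let combine f g r s : 0 < r -> 0 < s ->
  let a := r / (r + s) in
  0 <= a <= 1 /\ (fun t => (f t + g t) / (r + s)) =
    (fun t => a * (f t / r) + (1 - a) * (g t / s)) :> (T -> R).
Proof.
move=> r0 s0 a.
have rs0 : 0 < r + s by rewrite addr_gt0.
split.
  apply/andP; split; first by rewrite divr_ge0// ltW.
  by rewrite ler_pdivrMr// mul1r lerDl ltW.
have -> : 1 - a = s / (r + s).
  by rewrite /a -{1}(divff (lt0r_neq0 rs0)) -mulrBl addrAC subrr add0r.
apply/funext => t; rewrite /a mulrDl; congr (_ + _).
  by rewrite [RHS]mulrC mulrA divfK ?gt_eqF.
by rewrite [RHS]mulrC mulrA divfK ?gt_eqF.
Qed.

Lemma luxemburg_set_add f g r s : measurable_fun setT f -> measurable_fun setT g ->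
  luxemburg_set f r -> luxemburg_set g s -> luxemburg_set (f \+ g) (r + s).
Proof.
move=> mf mg [r0 fr] [s0 gs]; split; first by rewrite addr_gt0.
have [a01 /= ->] := combine f g r0 s0; set a := r / _ in a01 *.
have [a0 a1] := andP a01.
apply: (le_trans (modular_convex a01 (measurable_div r mf) (measurable_div s mg))).
apply: (@le_trans _ _ (a%:E * 1 + (1 - a)%:E * 1)%E).
  apply: leeD; apply: lee_wpmul2l.
  - by rewrite lee_fin.
  - exact: fr.
  - by rewrite lee_fin subr_ge0.
  - exact: gs.
by rewrite !mule1 -EFinD subrKC.
Qed.

Lemma luxemburg_set_finite f : luxemburg_set f !=set0 -> modular_finite f.
Proof. by move=> [r [r0 fr]]; exists r => //; rewrite (le_lt_trans fr)// ltry. Qed.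

Lemma luxemburg_normD f g : measurable_fun setT f -> measurable_fun setT g ->
  modular_finite f -> modular_finite g ->
  luxemburg_norm (f \+ g) <= luxemburg_norm f + luxemburg_norm g.
Proof.
move=> mf mg ff gg; rewrite /luxemburg_norm -inf_sumE; [|exact: luxemburg_set_has_inf..].
have [r fr] := luxemburg_set_nonempty mf ff; have [s gs] := luxemburg_set_nonempty mg gg.
apply: lb_le_inf; first by exists (r + s); exists r => //; exists s.
move=> _ [x fx [y gy <-]]; apply: luxemburg_norm_le; exact: luxemburg_set_add.
Qed.

Lemma luxemburg_set_scale (a : R) f r : a != 0 ->
  luxemburg_set f r -> luxemburg_set (fun t => a * f t) (`|a| * r).
Proof.
move=> a0 [r0 fr]; split; first by rewrite mulr_gt0// normr_gt0.
suff -> : modular (fun t => a * f t / (`|a| * r)) = modular (fun t => f t / r).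
  exact: fr.
apply: eq_integral => t _; congr (_ `^ _)%:E.
rewrite !normrM !normfV !normrM normr_id invfM mulrACA mulfV ?mul1r//.
by rewrite normr_eq0.
Qed.

Lemma luxemburg_norm0 : luxemburg_norm (cst 0) = 0.
Proof.
apply/eqP; rewrite eq_le; apply/andP; split.
  apply/ler_addgt0Pl => e e0; rewrite addr0; apply: luxemburg_norm_le; split => //.
  rewrite (_ : (fun _ => _) = cst 0) ?modular0//.
  by apply/funext => t /=; rewrite mul0r.
apply: lb_le_inf; last by move=> r [/ltW].
exists 1; split => //; rewrite (_ : (fun _ => _) = cst 0) ?modular0//.
by apply/funext => t /=; rewrite mul0r.
Qed.

Lemma luxemburg_normZ_le (a : R) f : measurable_fun setT f -> modular_finite f ->
  a != 0 -> luxemburg_norm (fun t => a * f t) <= `|a| * luxemburg_norm f.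
Proof.
move=> mf ff a0; have na0 : 0 < `|a| by rewrite normr_gt0.
rewrite -ler_pdivrMl//; apply: lb_le_inf; first exact: luxemburg_set_nonempty.
by move=> r fr; rewrite ler_pdivrMl//; apply: luxemburg_norm_le; exact: luxemburg_set_scale.
Qed.

Lemma modular_finite_scale (a : R) f : measurable_fun setT f -> modular_finite f ->
  modular_finite (fun t => a * f t).
Proof.
move=> mf ff; have [->|a0] := eqVneq a 0.
  exists 1 => //; rewrite (_ : (fun _ => _) = cst 0) ?modular0 ?ltry//.
  by apply/funext => t /=; rewrite !mul0r.
apply: luxemburg_set_finite; have [r fr] := luxemburg_set_nonempty mf ff.
by exists (`|a| * r); exact: luxemburg_set_scale.
Qed.

Lemma luxemburg_normZ (a : R) f : measurable_fun setT f -> modular_finite f ->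
  luxemburg_norm (fun t => a * f t) = `|a| * luxemburg_norm f.
Proof.
move=> mf ff; have [->|a0] := eqVneq a 0.
  rewrite normr0 mul0r -[RHS]luxemburg_norm0; congr luxemburg_norm.
  by apply/funext => t; rewrite mul0r.
apply/eqP; rewrite eq_le luxemburg_normZ_le//= -ler_pdivlMl ?normr_gt0//.
have maf : measurable_fun setT (fun t => a * f t) by exact: measurable_funM.
have := luxemburg_normZ_le maf (modular_finite_scale a mf ff) (invr_neq0 a0).
rewrite normfV (_ : (fun t => a^-1 * (a * f t)) = f)//.
by apply/funext => t; rewrite mulKf.
Qed.

Lemma luxemburg_norm_eq0 f : measurable_fun setT f -> modular_finite f ->
  luxemburg_norm f = 0 -> f = cst 0 %[ae mu].
Proof.
move=> mf ff f0.
have mod0 : modular f = 0%E.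
  apply/eqP; rewrite eq_le modular_ge0 andbT.
  apply/lee_addgt0Pr => e e0; rewrite add0e.
  have m0 : 0 < Num.min 1 e by rewrite lt_min ltr01.
  have [s [s0 fs]] := inf_adherent m0 (luxemburg_set_has_inf mf ff).
  rewrite -/(luxemburg_norm f) f0 add0r lt_min => /andP[s1 se].
  rewrite (_ : f = (fun t => s * (f t / s))); last first.
    by apply/funext => t; rewrite mulrC divfK// gt_eqF.
  apply: (le_trans (modular_scale _ (measurable_div s mf))).
    by rewrite (ltW s0) (ltW s1).
  apply: (@le_trans _ _ (s%:E * 1)%E).
    by rewrite lee_wpmul2l// lee_fin ltW.
  by rewrite mule1 lee_fin ltW.
have /(ae_eq_integral_abs mu measurableT (measurable_modular mf)) :
    (\int[mu]_t `|(`|f t| `^ p t)%:E|)%E = 0%E.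
  rewrite -[RHS]mod0; apply: eq_integral => t _.
  by rewrite gee0_abs// lee_fin powR_ge0.
apply: filterS => t /= /(_ I) [] /eqP; rewrite powR_eq0 p_neq0 andbT.
by rewrite normr_eq0 => /eqP.
Qed.

Definition varLp_pred : {pred L0} := mem [set f : L0 | modular_finite f].

Record varLp := VarLpOf { varLp_val :> L0; _ : varLp_val \in varLp_pred }.

HB.instance Definition _ := [isSub for varLp_val].
HB.instance Definition _ := [Choice of varLp by <:].

Lemma modular_finite_ae (f g : T -> R) : measurable_fun setT f ->
  measurable_fun setT g -> f = g %[ae mu] ->
  modular_finite f -> modular_finite g.
Proof.
move=> mf mg fg [r r0 fr]; exists r; first exact: r0.
suff <- : modular (fun t => f t / r) = modular (fun t => g t / r) by exact: fr.
apply: modular_ae; [exact: measurable_div..|].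
by apply: filterS fg => t /= + _ => /(_ I) ->.
Qed.

Lemma luxemburg_norm_ae (f g : T -> R) : measurable_fun setT f ->
  measurable_fun setT g -> f = g %[ae mu] ->
  luxemburg_norm f = luxemburg_norm g.
Proof.
move=> mf mg fg; rewrite /luxemburg_norm.
have H r : modular (fun t => f t / r) = modular (fun t => g t / r).
  apply: modular_ae; [exact: measurable_div..|].
  by apply: filterS fg => t /= + _ => /(_ I) ->.
suff -> : luxemburg_set f = luxemburg_set g by [].
apply/seteqP; split=> r [r0 fr]; split; [exact: r0| |exact: r0|].
- by rewrite -H; exact: fr.
- by rewrite H; exact: fr.
Qed.

Let mL0 (f : L0) : measurable_fun setT f.
Proof. exact: (measurable_funP (repr f)). Qed.

Let finite0 : modular_finite (0 : L0).
Proof.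
apply: (modular_finite_ae (measurable_cst (0 : R)) (mL0 0)).
  exact/ae_eq_sym/(L0_zeroE mu).
apply: luxemburg_set_finite; exists 1; split; first exact: ltr01.
rewrite (_ : (fun _ => _) = cst 0) ?modular0//.
by apply/funext => t /=; rewrite mul0r.
Qed.

Let finiteP (a : R) (f g : L0) : modular_finite f -> modular_finite g ->
  modular_finite (a *: f + g : L0).
Proof.
move=> ff gg.
have maf : measurable_fun setT (fun t => a * f t) by exact: measurable_funM.
have faf := modular_finite_scale a (mL0 f) ff.
have [r fr] := luxemburg_set_nonempty maf faf.
have [s gs] := luxemburg_set_nonempty (mL0 g) gg.
apply: (@modular_finite_ae ((fun t => a * f t) \+ g) (a *: f + g : L0)).
- exact: measurable_funD.
- exact: mL0.
- apply: ae_eq_sym; apply: ae_eq_trans (L0_addE (a *: f) g) _.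
  by apply: filterS (L0_scaleE a f) => t /= + _ => /(_ I) ->.
- by apply: luxemburg_set_finite; exists (r + s); exact: (luxemburg_set_add maf (mL0 g) fr gs).
Qed.

Let varLp_submod_closed : submod_closed varLp_pred.
Proof.
split; first exact/mem_set/finite0.
move=> a f g /set_mem ff /set_mem gg; apply/mem_set; exact: finiteP ff gg.
Qed.

HB.instance Definition _ :=
  GRing.isSubmodClosed.Build R L0 varLp_pred varLp_submod_closed.
HB.instance Definition _ := [SubChoice_isSubLmodule of varLp by <:].

Lemma varLp_finite (f : varLp) : modular_finite f.
Proof. by case: f => f fP; exact: set_mem fP. Qed.

Definition varLp_norm (f : varLp) : R := luxemburg_norm f.

Let varLp_normD (f g : varLp) :
  varLp_norm (f + g) <= varLp_norm f + varLp_norm g.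
Proof.
have mf := mL0 (varLp_val f); have mg := mL0 (varLp_val g).
rewrite /varLp_norm.
rewrite (luxemburg_norm_ae (mL0 _) (measurable_funD mf mg) (L0_addE _ _)).
exact: (luxemburg_normD mf mg (varLp_finite f) (varLp_finite g)).
Qed.

Let varLp_normZ (a : R) (f : varLp) :
  varLp_norm (a *: f) = `|a| * varLp_norm f.
Proof.
have mf := mL0 (varLp_val f).
have maf : measurable_fun setT (a \*: (varLp_val f : T -> R)).
  exact: measurable_funM.
rewrite /varLp_norm (luxemburg_norm_ae (mL0 _) maf (L0_scaleE a _)).
exact: (luxemburg_normZ a mf (varLp_finite f)).
Qed.

Let varLp_norm_eq0 (f : varLp) : varLp_norm f = 0 -> f = 0.
Proof.
move=> N0; have f0 := luxemburg_norm_eq0 (mL0 (varLp_val f)) (varLp_finite f) N0.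
apply/val_inj/eq_L0P; exact: ae_eq_trans f0 (ae_eq_sym (L0_zeroE mu)).
Qed.

HB.instance Definition _ := Lmodule_isNormed.Build R varLp
  varLp_normD varLp_normZ varLp_norm_eq0.

End variable_Lebesgue_space.

Section inclusion.
Context d (T : measurableType d) (R : realType).
Variables (mu : {finite_measure set T -> \bar R}) (p : exponent T R).

Lemma Linfty_sub_varLp (f : Linfty mu) : Linfty_val f \in varLp_pred p.
Proof.
have mf : measurable_fun setT f by exact: (measurable_funP (repr _)).
have [M M1 fM] : exists2 M : R, 1 <= M & \forall t \ae mu, `|f t| <= M.
  have := Linfty_finite f; rewrite /finite_norm unlock /Lnorm.
  case: ifPn => [mu0 /ess_supr_bounded[M fM]|mu0 _].
    exists (Num.max 1 M); first by rewrite le_max lexx.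
    by apply: filterS fM => t ftM; rewrite le_max ftM orbT.
  exists 1 => //; exists setT; split => //.
  by apply/eqP; rewrite eq_le measure_ge0 andbT leNgt.
have M0 : 0 < M by rewrite (lt_le_trans ltr01).
rewrite inE /=; exists M => //.
apply: (@le_lt_trans _ _ (\int[mu]_t (1%:E : \bar R))%E).
  apply: ae_ge0_le_integral => //.
  - apply: measurable_modular; exact: measurable_funM.
  - apply: filterS fM => t ftM _; rewrite lee_fin.
    rewrite -[leRHS](congr1 (@^~ (p t)) (powR1 R)) ge0_ler_powR ?nnegrE//.
      by rewrite (le_trans ler01)// exponent_ge1.
    by rewrite normrM normfV (gtr0_norm M0) ler_pdivrMr// mul1r.
by rewrite integral_cst// mul1e fin_num_fun_lty.
Qed.

Definition inclusion (f : Linfty mu) : varLp mu p :=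
  VarLpOf (Linfty_sub_varLp f).

Let inclusion_linear : linear inclusion.
Proof. by move=> a f g; apply: val_inj. Qed.

HB.instance Definition _ := GRing.isLinear.Build R (Linfty mu) (varLp mu p)
  *:%R inclusion inclusion_linear.

End inclusion.
Arguments inclusion {d T R} mu p f.

Section rearrangement.
Context d (T : measurableType d) (R : realType).
Variable mu : {measure set T -> \bar R}.

Definition atomless : Prop :=
  forall A, measurable A -> (0 < mu A)%E ->
    exists B, [/\ measurable B, B `<=` A, (0 < mu B)%E & (mu B < mu A)%E].

Definition Lexp0 : set (T -> R) :=
  [set f | measurable_fun setT f /\
    forall r : R, 0 < r -> (\int[mu]_t (expR `|r * f t|)%:E < +oo)%E].

Definition distribution_function (f : T -> R) (s : R) : \bar R :=
  mu [set t | s < `|f t|].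

(* The infimum is taken in the extended reals, so that the rearrangement at 0
   of an essentially unbounded function is +oo (infimum of the empty set). *)
Definition rearrangement (f : T -> R) (x : R) : \bar R :=
  ereal_inf [set s%:E | s in
    [set s : R | 0 <= s /\ (distribution_function f s <= x%:E)%E]].

End rearrangement.

(* Main.v *)
Require Import Defs.
From mathcomp Require Import all_boot all_order all_algebra.
From mathcomp Require Import all_classical all_reals all_analysis.
From mathcomp Require Import measurable_realfun ess_sup_inf ring lra.

Set Implicit Arguments.
Unset Strict Implicit.
Unset Printing Implicit Defensive.
Import Order.TTheory GRing.Theory Num.Theory.
Import numFieldNormedType.Exports.
Local Open Scope classical_set_scope.
Local Open Scope ring_scope.

(** Write D t for the measure of the set where p > t.  Each of the four
    conditions says that D decays faster than every exponential, i.e. that for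
    all r > 0 one has D t <= exp (- r t) for large t ([superexponential_tail]).

    Exponential integrability at every rate is this decay by Markov's inequality
    in one direction ([Lexp0_tail]) and by summing over unit levels of p in the
    other ([tail_Lexp0]).

    The rearrangement p^* is the generalized inverse of D, so the decay means
    that p^* s = o(ln (1 / s)) at 0.  Since x (1 - ln x) is a primitive of
    - ln x, averaging preserves this bound, and it loses nothing because
    x p^* x is at most the integral of p^* over [0, x]
    ([tail_average_rearrangement], [average_rearrangement_tail]).  With M the
    total mass, passing to complements shows that (1 / p)^* (M - y) is
    essentially 1 / p^* y; as y ^ (1 / a) = exp (- ln (1 / y) / a), the last
    limit says once more that p^* y = o(ln (1 / y))
    ([tail_powR_rearrangement_inv], [powR_rearrangement_inv_tail]).

    If the decay fails at the rate r, the space splits into countably many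
    blocks, each containing a set on which p >= t and whose measure exceeds
    exp (- r t).  A function of modulus at least exp r on such a set has modular
    greater than 1, so on the bounded functions that are constant on each block,
    a copy of l^oo, the uniform norm is at most exp r times the Luxemburg norm.
    The inclusion is then an isomorphism on an infinite-dimensional closed
    subspace ([strictly_singular_Lexp0]).

    Conversely, let |f|_oo <= K |f|_p on a subspace V.  If |f|_oo = 1, then the
    modular of 2 K f is greater than 1.  The set where f is small contributes
    at most 1/2 to it, and on the rest the integrand is at most (2 K)^p, which
    is integrable when p is exponentially integrable at every rate.  By absolute
    continuity f is not small on a set whose measure is bounded below, so that
    |f|_oo <= C |f|_2 on V ([Lexp0_L2_lower_bound]), and a theorem of
    Grothendieck makes V finite-dimensional ([finite_dimensional_L2]).  This
    gives [Lexp0_strictly_singular]. *)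

(** * Rearrangements and the decay of distribution functions *)

Definition superexponential_tail d (T : measurableType d) (R : realType)
    (mu : {measure set T -> \bar R}) (f : T -> R) : Prop :=
  forall r : R, 0 < r ->
    \forall t \near +oo, (distribution_function mu f t <= (expR (- (r * t)))%:E)%E.

Lemma cvg_ge0_to0P (R : realType) (I : Type) (F : set_system I) (FF : Filter F)
    (f : I -> \bar R) : (\forall x \near F, (0 <= f x)%E) ->
  f x @[x --> F] --> 0%E <->
  (forall e : R, 0 < e -> \forall x \near F, (f x <= e%:E)%E).
Proof.
move=> f0; split=> [/fine_cvgP[ffin /cvgrPdist_le f_cvg] e e0|fe].
  near=> x; rewrite -[f x]fineK; last by near: x.
  rewrite lee_fin (le_trans (ler_norm _))//.
  by rewrite -normrN -sub0r; near: x; exact: f_cvg.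
apply/fine_cvgP; split.
  (* An eventual bound, here 1, is what rules out infinite values. *)
  near=> x; rewrite ge0_fin_numE; last by near: x.
  by rewrite (@le_lt_trans _ _ 1%:E) ?ltry//; near: x; exact: fe.
apply/cvgrPdist_le => e e0; near=> x.
have fx0 : (0 <= f x)%E by near: x.
have fxe : (f x <= e%:E)%E by near: x; exact: fe.
rewrite sub0r normrN /= ger0_norm ?fine_ge0// -lee_fin fineK//.
by rewrite ge0_fin_numE// (le_lt_trans fxe)// ltry.
Unshelve. all: by end_near. Qed.

Section rearrangement.
Context d (T : measurableType d) (R : realType).
Variables (mu : {measure set T -> \bar R}) (f : T -> R).
Hypothesis mf : measurable_fun setT f.
Local Notation D := (distribution_function mu f).
Local Notation "f ^*" := (rearrangement mu f).

Lemma measurable_superlevel s : measurable [set t | s < `|f t|].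
Proof.
rewrite [X in measurable X](_ : _ = (Num.norm \o f) @^-1` `]s, +oo[); last first.
  by apply/seteqP; split=> t /=; rewrite in_itv/= andbT.
rewrite -[X in measurable X]setTI.
have mnf : measurable_fun setT (Num.norm \o f) by exact: measurableT_comp.
by apply: mnf => //; exact: measurable_itv.
Qed.

Lemma le_distribution s t : s <= t -> (D t <= D s)%E.
Proof.
move=> st; apply: le_measure; rewrite ?inE; [exact: measurable_superlevel..|].
by move=> u /=; exact: le_lt_trans.
Qed.

Lemma rearrangement_ge0 x : (0 <= f^* x)%E.
Proof. by apply: le_ereal_inf_tmp => _ [s [s0 _] <-]; rewrite lee_fin. Qed.

Lemma rearrangement_le s x : 0 <= s -> (D s <= x%:E)%E -> (f^* x <= s%:E)%E.
Proof. by move=> s0 Ds; apply: ereal_inf_lbound; exists s. Qed.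

(** Together with [rearrangement_le], this makes the rearrangement a generalized
    inverse of the distribution function.  Strictness provides an admissible level
    below s, which avoids appealing to the right-continuity of the distribution
    function. *)
Lemma rearrangement_lt s x : (f^* x < s%:E)%E -> (D s <= x%:E)%E.
Proof.
move=> /ereal_inf_lt[_ [t [_ Dt] <-]]; rewrite lte_fin => ts.
by apply: le_trans Dt; apply: le_distribution; exact: ltW.
Qed.

Lemma rearrangement_ge s x : (forall t, 0 <= t < s -> (x%:E < D t)%E) ->
  (s%:E <= f^* x)%E.
Proof.
move=> Dt; apply: le_ereal_inf_tmp => _ [t [t0 Dtx] <-]; rewrite lee_fin leNgt.
by apply/negP => ts; move: Dtx; rewrite leNgt Dt ?t0.
Qed.

Lemma le_rearrangement x y : x <= y -> (f^* y <= f^* x)%E.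
Proof.
move=> xy; apply: le_ereal_inf_tmp => _ [s [s0 Dsx] <-].
by apply: rearrangement_le => //; apply: le_trans Dsx _; rewrite lee_fin.
Qed.

(** The superlevel sets of a nonincreasing function are intervals. *)
Lemma measurable_rearrangement (A : set R) : measurable A ->
  measurable_fun A (rearrangement mu f).
Proof.
move=> mA; apply: (measurability _ (ErealGenOInfty.measurableE R)) => //.
move=> _ [_ [a ->] <-]; apply: measurableI => //.
apply: is_interval_measurable => s t /=.
rewrite !in_itv/= !andbT => fs ft u /andP[_ ut].
by rewrite in_itv/= andbT; apply: (lt_le_trans ft); exact: le_rearrangement.
Qed.

End rearrangement.

(** * Exponential integrability *)

(** A function below a constant plus a series of weighted indicators has an
    integral below the corresponding series of measures; the weighted measures
    are compared with the geometric series of sum b so that no summability has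
    to be discussed.  The pointwise bound only asks for a finite partial sum,
    which may depend on the point. *)
Lemma integral_le_dyadic d (T : measurableType d) (R : realType)
    (mu : {measure set T -> \bar R}) (E : set T) (f : T -> \bar R)
    (a b : R) (c : nat -> R) (A : nat -> set T) :
  measurable E -> (forall k, measurable (A k)) -> measurable_fun E f ->
  (forall x, E x -> (0 <= f x)%E) -> 0 <= a -> 0 <= b -> (forall k, 0 <= c k) ->
  (forall x, E x -> exists n : nat,
     (f x <= (a + \sum_(k < n) c k * \1_(A k) x)%:E)%E) ->
  (forall k, ((c k)%:E * mu (A k `&` E) <= (b / (2 ^ k.+1)%:R)%:E)%E) ->
  (\int[mu]_(x in E) f x <= a%:E * mu E + b%:E)%E.
Proof.
move=> mE mA mf f0 a0 b0 c0 fle Ale.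
pose g k x : \bar R := (c k * \1_(A k) x)%:E.
have g0 k x : (0 <= g k x)%E by rewrite lee_fin mulr_ge0.
have mg k : measurable_fun E (g k).
  by apply/measurable_EFinP; apply: measurable_funM.
apply: (@le_trans _ _ (\int[mu]_(x in E) (a%:E + \sum_(0 <= k <oo) g k x))%E).
  apply: ge0_le_integral => //.
    apply: emeasurable_funD => //.
    by apply: ge0_emeasurable_sum => // k x _ _; exact: g0.
  move=> x Ex; have [n] := fle x Ex; move=> /le_trans; apply.
  rewrite EFinD leeD2l// -sumEFin -(big_mkord xpredT (fun k => (c k * \1_(A k) x)%:E)).
  by apply: (@nneseries_lim_ge _ (g ^~ x)) => k _ _; exact: g0.
rewrite ge0_integralD//; last 2 first.
- by move=> x _; apply: nneseries_ge0 => k _ _; exact: g0.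
- by apply: ge0_emeasurable_sum => // k x _ _; exact: g0.
rewrite integral_cst//; apply: leeD => //.
rewrite integral_nneseries//; apply: le_trans (epsilon_trick0 xpredT b0).
apply: lee_nneseries => [k _ _|k _].
  by apply: integral_ge0 => x _; exact: g0.
rewrite /g; under eq_integral do rewrite EFinM.
rewrite ge0_integralZl_EFin//; first by rewrite integral_indic.
exact/measurable_EFinP.
Qed.

Lemma expR_ge_exp2 (R : realType) (n : nat) (x : R) : n%:R <= x -> (2 ^ n)%:R <= expR x.
Proof.
move=> nx; apply: (@le_trans _ _ (expR n%:R)); last by rewrite ler_expR.
rewrite -[n%:R]mulr1 expRM_natl natrX lerXn2r ?nnegrE ?expR_ge0//.
exact: expR_ge1Dx.
Qed.

Section exponential_integrability.
Context d (T : measurableType d) (R : realType).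
Variables (mu : {finite_measure set T -> \bar R}) (f : T -> R).
Hypothesis mf : measurable_fun setT f.
Local Notation D := (distribution_function mu f).

Let measurable_expR_norm (r : R) :
  measurable_fun setT (fun t => (expR `|r * f t|)%:E).
Proof.
apply/measurable_EFinP; apply: measurableT_comp => //.
by apply: measurableT_comp => //; exact: measurable_funM.
Qed.

(** Markov's inequality at the rate r + 1: the spare factor exp (- t) absorbs the
    integral for large t. *)
Lemma Lexp0_tail : Lexp0 mu f -> superexponential_tail mu f.
Proof.
move=> [_ fexp] r r0; have r1 : 0 < r + 1 by rewrite addr_gt0.
have Ioo := fexp _ r1; set I := (\int[mu]_t _)%E in Ioo.
have I0 : (0 <= I)%E by apply: integral_ge0 => t _; rewrite lee_fin expR_ge0.
have Ifin : I \is a fin_num by rewrite ge0_fin_numE.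
near=> t; have It : fine I <= expR t.
  apply: (@le_trans _ _ t); last by rewrite (le_trans _ (expR_ge1Dx t))// lerDr.
  by near: t; apply: nbhs_pinfty_ge; exact: num_real.
have := le_integral_abse mu measurableT (measurable_expR_norm (r + 1))
  (expR_gt0 ((r + 1) * t)).
under eq_integral do rewrite gee0_abs ?lee_fin ?expR_ge0//.
rewrite -/I setTI => markov.
have {markov} : ((expR ((r + 1) * t))%:E * D t <= (expR t)%:E)%E.
  apply: (@le_trans _ _ I); last by rewrite -[I]fineK// lee_fin.
  apply: le_trans markov; apply: lee_wpmul2l; first by rewrite lee_fin expR_ge0.
  apply: le_measure; rewrite ?inE.
  - exact: measurable_superlevel.
  - rewrite -[X in measurable X]setTI; apply: emeasurable_fun_c_infty => //.
    exact: measurableT_comp.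
  move=> u /= tu; rewrite lee_fin ger0_norm ?expR_ge0// ler_expR normrM.
  by rewrite (gtr0_norm r1) ler_pM2l// ltW.
rewrite muleC -lee_pdivlMr ?expR_gt0// => /le_trans; apply.
rewrite -EFinM lee_fin -expRN -expRD ler_expR; lra.
Unshelve. all: by end_near. Qed.

(** Beyond a threshold N the rate r + 1 is available, so the unit level starting
    at N + k contributes at most about exp (r k) exp (- (r + 1) k) = exp (- k),
    which is at most 2 ^ (- k). *)
Lemma tail_Lexp0 : superexponential_tail mu f -> Lexp0 mu f.
Proof.
move=> ftail; split=> // r r0; have r1 : 0 < r + 1 by rewrite addr_gt0.
have [N [N0 DN]] : exists N : R, 0 <= N /\
    forall t, N <= t -> (D t <= (expR (- ((r + 1) * t)))%:E)%E.
  have [N [_ ND]] := ftail _ r1; exists (`|N| + 1); split; first by rewrite addr_ge0.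
  move=> t Nt; apply: ND; apply: lt_le_trans Nt.
  by rewrite (le_lt_trans (ler_norm _))// ltrDl.
pose A k := [set t | N + k%:R < `|f t|].
pose c k : R := expR (r * (N + k%:R + 2)).
apply: (@le_lt_trans _ _ ((expR (r * N))%:E * mu setT + (expR (r * 2) * 2)%:E)%E).
  apply: (@integral_le_dyadic _ _ _ _ _ _ _ _ c A) => //; rewrite ?expR_ge0//.
  - by move=> k; exact: measurable_superlevel.
  - by move=> k; exact: expR_ge0.
  - move=> t _; have rf : `|r * f t| = r * `|f t| by rewrite normrM gtr0_norm.
    have [ftN|Nft] := leP `|f t| N.
      exists 0; rewrite big_ord0 addr0 lee_fin ler_expR rf ler_pM2l//.
    (* When f t lies in the level of index m > 0, only the strict inequality
       N + m - 1 < |f t| is certain, hence the term of index m - 1 and the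
       constant 2 in [c]. *)
    pose m := Num.truncn (`|f t| - N).
    have := truncn_itv (ltW (_ : 0 < `|f t| - N)); rewrite subr_gt0 => /(_ Nft).
    rewrite -/m => /andP[mf1 mf2].
    exists m.-1.+1; rewrite big_ord_recr/= lee_fin.
    have At : \1_(A m.-1) t = 1 :> R.
      rewrite indicE mem_set//= /A /=; move: mf1; case: m {mf2} => [|m].
        by rewrite addr0.
      by rewrite -natr1 /=; lra.
    rewrite At mulr1 addrA ler_wpDl//.
      by rewrite addr_ge0 ?expR_ge0// sumr_ge0// => i _; rewrite mulr_ge0 ?expR_ge0.
    rewrite ler_expR rf ler_pM2l//; move: mf2; case: m {mf1 At} => [|m] /=.
      by rewrite addr0; lra.
    by rewrite -!natr1; lra.
  - move=> k; rewrite setIT.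
    have Nk : N <= N + k%:R by rewrite lerDl.
    apply: (@le_trans _ _ ((c k)%:E * (expR (- ((r + 1) * (N + k%:R))))%:E)%E).
      by apply: lee_wpmul2l; [rewrite lee_fin expR_ge0|exact: DN].
    rewrite -EFinM lee_fin /c -expRD expnS natrM invfM mulrA mulfK ?pnatr_eq0//.
    rewrite ler_pdivlMr ?ltr0n ?expn_gt0//.
    apply: (@le_trans _ _ (expR (r * 2 - k%:R) * expR k%:R)).
      rewrite ler_pM ?expR_ge0 ?ler0n//; first by rewrite ler_expR; lra.
      exact: expR_ge_exp2.
    by rewrite -expRD subrK.
rewrite lte_add_pinfty ?ltry// lte_mul_pinfty ?lee_fin ?expR_ge0//.
exact: fin_num_fun_lty.
Qed.

End exponential_integrability.

(** * Averages of the rearrangement *)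

Lemma near_expRN (R : realType) (P : R -> Prop) (r : R) : 0 < r ->
  (\forall x \near 0^'+, P x) -> \forall t \near +oo, P (expR (- (r * t))).
Proof.
move=> r0 [e /= e0 eP]; near=> t; apply: eP; rewrite /ball_ /= ?expR_gt0//.
rewrite sub0r normrN gtr0_norm ?expR_gt0//.
rewrite -[e]lnK ?posrE// ltr_expR ltrNl -ltr_pdivrMl//.
by near: t; apply: nbhs_pinfty_gt; exact: num_real.
Unshelve. all: by end_near. Qed.

(** Reflection at M turns the left limit at M into a right limit at 0. *)
Lemma near_sub_left (R : realType) (M : R) (P : R -> Prop) :
  (\forall x \near within `[0, M[ (nbhs M), P x) <->
  \forall y \near 0^'+, y <= M -> P (M - y).
Proof.
split=> -[e /= e0 eP]; exists e => //=.
- move=> y; rewrite /ball_ /= sub0r normrN => ye y0 yM; apply: eP.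
    by rewrite /ball_ /= subKr.
  by rewrite /= in_itv/= subr_ge0 yM ltrBlDr ltrDl.
- move=> x; rewrite /ball_ /= => xe; rewrite in_itv/= => /andP[x0 xM].
  rewrite -[x](subKr M); apply: eP; rewrite ?subr_gt0 ?gerBl//.
  by rewrite /ball_ /= sub0r normrN.
Qed.

Lemma measurable_Nln (R : realType) (A : set R) :
  measurable_fun A (fun s => (- ln s)%:E).
Proof.
apply/measurable_EFinP; apply: measurable_funN.
by apply: measurable_funTS; exact: measurable_ln.
Qed.

(** The exact value is x (1 - ln x).  The bound suffices for a statement about
    o(x (1 - ln x)) and spares the improper integral: at s the number of k with
    s <= x / 2 ^ k exceeds ln x - ln s, and the measures of these nested
    intervals sum up to 2 x. *)
Lemma integral_Nln_le (R : realType) (x : R) : 0 < x -> x <= 1 ->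
  (\int[lebesgue_measure]_(s in `]0%R, x]) (- ln s)%:E <= (x * (2 - ln x))%:E)%E.
Proof.
move=> x0 x1; have lnx0 : ln x <= 0 by exact: ln_le0.
have mIoc (a b : R) : a <= b ->
    lebesgue_measure (`]a, b]%classic : set R) = (b - a)%:E.
  move=> ab; rewrite lebesgue_measure_itv/= lte_fin EFinB.
  by case: ltP => // ba; rewrite -EFinB (le_anti (_ : a <= b <= a)) ?ab// subrr.
pose A k : set R := `]0, x / (2 ^ k)%:R]%classic.
have h2 k : 0 < (2 ^ k)%:R :> R by rewrite ltr0n expn_gt0.
apply: (@le_trans _ _ ((- ln x)%:E * lebesgue_measure (`]0%R, x]%classic : set R)
    + (x * 2)%:E)%E); last first.
  by rewrite mIoc ?(ltW x0)// -EFinM -EFinD lee_fin subr0; lra.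
apply: (@integral_le_dyadic _ _ _ (@lebesgue_measure R) _
  (fun s : R => (- ln s)%:E) (- ln x) (x * 2) (fun=> 1) A) => //.
- by move=> k; exact: measurable_itv.
- exact: measurable_Nln.
- move=> s /=; rewrite in_itv/= => /andP[_ sx].
  by rewrite lee_fin oppr_ge0 ln_le0// (le_trans sx).
- by rewrite oppr_ge0.
- by rewrite mulr_ge0// ltW.
- move=> s /=; rewrite in_itv/= => /andP[s0 sx].
  pose l := ln x - ln s.
  have l0 : 0 <= l by rewrite subr_ge0 ler_ln ?posrE.
  exists (Num.truncn l).+1; have := truncn_itv l0; set m := Num.truncn l => /andP[ml lm].
  rewrite (eq_bigr (fun=> 1)) ?sumr_const ?card_ord; last first.
    (* 2 ^ k <= exp k <= x / s for every k up to ln (x / s) *)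
    move=> [k /= km] _; rewrite mul1r indicE mem_set//= /A/= in_itv/= s0/=.
    rewrite ler_pdivlMr// mulrC -ler_pdivlMr//.
    apply: (@le_trans _ _ (expR l)).
      apply: expR_ge_exp2; apply: le_trans ml; rewrite ler_nat; exact: km.
    by rewrite /l expRD expRN !lnK ?posrE.
  by rewrite lee_fin; move: lm; rewrite /l; lra.
- move=> k; rewrite mul1e.
  apply: (@le_trans _ _ (lebesgue_measure (A k))).
    have mA : measurable (A k) by exact: measurable_itv.
    by apply: le_measure; rewrite ?inE//; exact: measurableI.
  rewrite mIoc; last by rewrite divr_ge0// ltW.
  by rewrite subr0 lee_fin expnS natrM invfM mulrA mulfK ?pnatr_eq0.
Qed.

Section rearrangement_averages.
Context d (T : measurableType d) (R : realType).
Variables (mu : {measure set T -> \bar R}) (f : T -> R).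
Hypothesis mf : measurable_fun setT f.
Local Notation D := (distribution_function mu f).
Local Notation "f ^*" := (rearrangement mu f).
Local Notation average x :=
  ((\int[lebesgue_measure]_(s in `[0%R, x]) f^* s) / (x * ln (expR 1 / x))%R%:E)%E.

Lemma ln_expR1_div (x : R) : 0 < x -> ln (expR 1 / x) = 1 - ln x.
Proof. by move=> x0; rewrite ln_div ?posrE ?expR_gt0// expRK. Qed.

Let average_ge0 : \forall x \near 0^'+, (0 <= average x)%E.
Proof.
near=> x; have x0 : 0 < x by [].
have x1 : x <= 1 by near: x; exact: nbhs_right_le.
have den0 : 0 < x * ln (expR 1 / x).
  by rewrite mulr_gt0// ln_expR1_div//; have := ln_le0 x1; lra.
rewrite inver gt_eqF// mule_ge0//.
  by apply: integral_ge0 => s _; exact: rearrangement_ge0.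
by rewrite lee_fin invr_ge0 ltW.
Unshelve. all: by end_near. Qed.

Let average_leP (x e : R) : 0 < x <= 1 ->
  (average x <= e%:E)%E =
  (\int[lebesgue_measure]_(s in `[0%R, x]) f^* s <= (e * (x * (1 - ln x)))%:E)%E.
Proof.
move=> /andP[x0 x1]; have den0 : 0 < x * (1 - ln x).
  by rewrite mulr_gt0//; have := ln_le0 x1; lra.
by rewrite ln_expR1_div// inver gt_eqF// lee_pdivrMr// EFinM.
Qed.

(** Decay at the rate r gives p^* s <= - ln s / r near 0.  With r = 2 / e and the
    preceding integral, the average is at most
    (e / 2) (2 - ln x) / (1 - ln x) <= e. *)
Lemma tail_average_rearrangement : superexponential_tail mu f ->
  average x @[x --> 0^'+] --> 0%E.
Proof.
move=> ftail; apply/(cvg_ge0_to0P _ average_ge0) => e e0.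
have r0 : 0 < 2 / e by rewrite divr_gt0.
have [N [_ DN]] := ftail _ r0; set r := 2 / e in r0 DN.
near=> x; have x0 : 0 < x by [].
have x1 : x <= 1 by near: x; exact: nbhs_right_le.
have xN : x < expR (- (r * N)) by near: x; apply: nbhs_right_lt; exact: expR_gt0.
(* The point 0 is dropped: the rearrangement may be infinite and the logarithm
   is 0 by convention there. *)
rewrite average_leP ?x0// -integral_itv_obnd_cbnd; last first.
  exact: measurable_rearrangement.
apply: (@le_trans _ _
    (\int[lebesgue_measure]_(s in `]0%R, x]) (r^-1%:E * (- ln s)%:E))%E).
  apply: ge0_le_integral => //.
  - by move=> s _; exact: rearrangement_ge0.
  - exact: measurable_rearrangement.
  - by apply: measurable_funeM; exact: measurable_Nln.
  move=> s /=; rewrite in_itv/= => /andP[s0 sx].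
  have sN : s < expR (- (r * N)) by exact: le_lt_trans xN.
  rewrite -EFinM; apply: rearrangement_le.
    by rewrite mulr_ge0 ?invr_ge0 ?(ltW r0)// oppr_ge0 ln_le0// (le_trans sx).
  apply: (le_trans (DN _ _)).
    rewrite ltr_pdivlMl// ltrNr -ltr_expR lnK ?posrE//.
  by rewrite mulVKf ?gt_eqF// opprK lnK ?posrE.
rewrite ge0_integralZl_EFin//; last 3 first.
- move=> s /=; rewrite in_itv/= => /andP[s0 sx].
  by rewrite lee_fin oppr_ge0 ln_le0// (le_trans sx).
- exact: measurable_Nln.
- by rewrite invr_ge0 ltW.
apply: (le_trans (lee_wpmul2l _ (integral_Nln_le x0 x1))).
  by rewrite lee_fin invr_ge0 ltW.
rewrite -EFinM lee_fin /r invf_div -subr_ge0.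
rewrite (_ : _ - _ = e * x * (- ln x) / 2); last by field.
by rewrite divr_ge0// mulr_ge0 ?oppr_ge0 ?ln_le0// mulr_ge0// ltW.
Unshelve. all: by end_near. Qed.

(** The value at x of a nonincreasing function is at most its mean over [0, x],
    so f^* x is at most e (1 - ln x) near 0.  At x = exp (- r t) with
    e = 1 / (r + 1), this is (1 + r t) / (r + 1), which is smaller than t as
    soon as t > 1. *)
Lemma average_rearrangement_tail : average x @[x --> 0^'+] --> 0%E ->
  superexponential_tail mu f.
Proof.
move=> /(cvg_ge0_to0P _ average_ge0) avg0 r r0.
have r1 : 0 < r + 1 by rewrite addr_gt0.
have /avg0 avge : 0 < (r + 1)^-1 by rewrite invr_gt0.
have star_le : \forall x \near 0^'+, (f^* x <= ((1 - ln x) / (r + 1))%:E)%E.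
  near=> x; have x0 : 0 < x by [].
  have x1 : x <= 1 by near: x; exact: nbhs_right_le.
  have : (average x <= (r + 1)^-1%:E)%E by near: x.
  rewrite average_leP ?x0// => Ile.
  have : (x%:E * f^* x <= (x * ((1 - ln x) / (r + 1)))%:E)%E.
    apply: (@le_trans _ _ (\int[lebesgue_measure]_(s in `[0%R, x]) f^* s)%E).
      apply: (@le_trans _ _ (\int[lebesgue_measure]_(s in `[0%R, x]) cst (f^* x) s)%E).
        rewrite integral_cst//= lebesgue_measure_itv/= lte_fin x0 sube0.
        by rewrite muleC.
      apply: ge0_le_integral => //.
      - by move=> s _; exact: rearrangement_ge0.
      - exact: measurable_rearrangement.
      move=> s /=; rewrite in_itv/= => /andP[_ sx].
      exact: le_rearrangement.
    by apply: (le_trans Ile); rewrite lee_fin mulrC -mulrA.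
  by rewrite EFinM lee_pmul2l// ?lte_fin.
have {}star_le : \forall t \near +oo,
    (f^* (expR (- (r * t))) <= ((1 - ln (expR (- (r * t)))) / (r + 1))%:E)%E.
  exact: (near_expRN r0 star_le).
near=> t; apply: (rearrangement_lt mf).
apply: (@le_lt_trans _ _ ((1 - ln (expR (- (r * t)))) / (r + 1))%:E).
  by near: t.
rewrite expRK opprK lte_fin ltr_pdivrMr//.
have : 1 < t by near: t; apply: nbhs_pinfty_gt; exact: num_real.
by lra.
Unshelve. all: by end_near. Qed.

End rearrangement_averages.

(** * Rearrangement of the reciprocal exponent *)

Lemma measure_setC_lt d (T : measurableType d) (R : realType)
    (mu : {measure set T -> \bar R}) (M y : R) (A : set T) :
  measurable A -> mu setT = M%:E ->
  ((M - y)%:E < mu A)%E = (mu (~` A) < y%:E)%E.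
Proof.
move=> mA muT; have AC : (mu A + mu (~` A) = M%:E)%E.
  by rewrite -muT -(setUv A) measureU//; [exact: measurableC|exact: setICr].
have fA : mu A \is a fin_num.
  by rewrite ge0_fin_numE// (le_lt_trans _ (ltry M))// -AC leeDl.
have fC : mu (~` A) \is a fin_num.
  by rewrite ge0_fin_numE// (le_lt_trans _ (ltry M))// -AC leeDr.
move: AC; rewrite -[mu A]fineK// -[mu (~` A)]fineK// -EFinD !lte_fin => -[<-].
by rewrite ltrBlDr ltrD2l.
Qed.

Section reciprocal_rearrangement.
Context d (T : measurableType d) (R : realType).
Variables (mu : {finite_measure set T -> \bar R}) (p : exponent T R).
Local Notation D := (distribution_function mu p).
Local Notation q := (rearrangement mu (fun t => (p t)^-1)).
Local Notation M := (fine (mu setT)).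

Let p_gt0 t : 0 < p t.
Proof. exact: lt_le_trans (exponent_ge1 p t). Qed.

Let measurable_inv_exponent : measurable_fun setT (fun t => (p t)^-1).
Proof.
rewrite (_ : (fun _ => _) = expR \o (fun t => - ln (p t))).
  apply: measurableT_comp; first exact: measurable_expR.
  apply: measurable_funN; apply: measurableT_comp; first exact: measurable_ln.
  exact: measurable_exponent.
by apply/funext => t /=; rewrite expRN lnK ?posrE.
Qed.

Let muE : mu setT = M%:E.
Proof. by rewrite fineK// fin_num_measure. Qed.

(** For s < 1 / c, the points with 1 / p <= s have p > c, so the superlevel set of
    1 / p at s misses less than y of the total mass. *)
Lemma rearrangement_inv_ge (c y : R) : 0 < c -> (D c < y%:E)%E ->
  (c^-1%:E <= q (M - y))%E.
Proof.
move=> c0 Dy; apply: rearrangement_ge => s /andP[s0 sc].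
have mA := measurable_superlevel measurable_inv_exponent s.
rewrite (measure_setC_lt _ mA muE); apply: le_lt_trans Dy.
apply: le_measure; rewrite ?inE.
- exact: measurableC.
- exact: (measurable_superlevel (measurable_exponent p)).
move=> t /= /negP; rewrite -leNgt !gtr0_norm ?invr_gt0// => ps.
by rewrite -ltf_pV2 ?posrE//; exact: le_lt_trans sc.
Qed.

(** The converse comparison: the superlevel set of 1 / p at 1 / t lies in the
    region p < t. *)
Lemma rearrangement_inv_lt (t y : R) : 0 < t -> (t^-1%:E < q (M - y))%E ->
  (D t <= y%:E)%E.
Proof.
move=> t0 tq; have mA := measurable_superlevel measurable_inv_exponent t^-1.
have : ((M - y)%:E < distribution_function mu (fun u => (p u)^-1)%R t^-1)%E.
  rewrite ltNge; apply/negP => muA; move: tq; rewrite ltNge => /negP; apply.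
  by apply: rearrangement_le => //; rewrite invr_ge0 ltW.
rewrite (measure_setC_lt _ mA muE) => /ltW; apply: le_trans.
apply: le_measure; rewrite ?inE.
- exact: (measurable_superlevel (measurable_exponent p)).
- exact: measurableC.
move=> u /= tu; apply/negP; rewrite -leNgt.
move: tu; rewrite !gtr0_norm ?invr_gt0// => tu.
by rewrite lef_pV2 ?posrE// ltW.
Qed.

Let q_fin x : 0 <= x -> q x \is a fin_num.
Proof.
move=> x0; rewrite ge0_fin_numE ?rearrangement_ge0//.
apply: (@le_lt_trans _ _ 1%:E); last exact: ltry.
apply: rearrangement_le => //; rewrite /distribution_function.
rewrite (_ : [set t | _] = set0) ?measure0 ?lee_fin//.
apply/seteqP; split=> // t /=; rewrite gtr0_norm ?invr_gt0//.
by rewrite ltNge invf_le1// exponent_ge1.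
Qed.

(** A bound on the power is a lower bound on the exponent, because the logarithm
    of y is negative. *)
Let powR_q_le (y L : R) : 0 < y < 1 -> y <= M ->
  (y `^ fine (q (M - y)) <= expR (- L)) = ((L / - ln y)%:E <= q (M - y))%E.
Proof.
move=> /andP[y0 y1] yM; have lny : 0 < - ln y by rewrite oppr_gt0 ln_lt0// y0.
rewrite /powR gt_eqF// ler_expR -[X in (_ = (_ <= X)%E)]fineK ?q_fin ?subr_ge0//.
by rewrite lee_fin ler_pdivrMr// mulrN lerNr.
Qed.

Local Notation condition :=
  ((M - x) `^ fine (q x) @[x --> within `[0, M[ (nbhs M)] --> (0 : R)).

(** To make the power at most exp (- L), the rearrangement has to be at least
    L / - ln y, that is D c < y for c = - ln y / L.  Decay at the rate 2 L gives
    D c <= exp (- 2 L c) = y ^ 2. *)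
Lemma tail_powR_rearrangement_inv : superexponential_tail mu p -> condition.
Proof.
move=> ptail; apply/cvgrPdist_le => e e0.
apply/near_sub_left.
pose L := Num.max 1 (- ln e).
have L0 : 0 < L by rewrite lt_max ltr01.
have Le : expR (- L) <= e.
  rewrite -[leRHS]lnK ?posrE// ler_expR lerNl.
  by rewrite le_max lexx orbT.
have [N [_ DN]] : \forall t \near +oo, (D t <= (expR (- (2 * L * t)))%:E)%E.
  by apply: ptail; rewrite mulr_gt0.
near=> y => yM; have y0 : 0 < y by [].
have y1 : y < 1 by near: y; apply: nbhs_right_lt.
have lny : 0 < - ln y by rewrite oppr_gt0 ln_lt0// y0.
rewrite subKr sub0r normrN ger0_norm ?powR_ge0// (le_trans _ Le)//.
rewrite powR_q_le ?y0// -[_ / _]invrK invf_div.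
apply: rearrangement_inv_ge; first by rewrite divr_gt0.
apply: (le_lt_trans (DN _ _)).
  rewrite ltr_pdivlMr// ltrNr -ltr_expR lnK ?posrE//.
  by near: y; apply: nbhs_right_lt; exact: expR_gt0.
rewrite lte_fin -[ltRHS]lnK ?posrE// ltr_expR.
rewrite -mulrA (mulrC L) divfK ?gt_eqF//; lra.
Unshelve. all: by end_near. Qed.

(** Take y = exp (- r t).  If the power is at most exp (- 2 r), the rearrangement
    is at least 2 r / (r t) = 2 / t, which exceeds 1 / t. *)
Lemma powR_rearrangement_inv_tail : condition -> superexponential_tail mu p.
Proof.
move=> /cvgrPdist_le cond r r0.
have e0 : 0 < expR (- (2 * r)) by exact: expR_gt0.
have /near_sub_left {}cond := cond _ e0.
have small : \forall y \near (0 : R)^'+, 0 < y < 1.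
  near=> y; have y0 : 0 < y by [].
  have y1 : y < 1 by near: y; apply: nbhs_right_lt.
  by rewrite y0.
have {}small := near_expRN r0 small; have {}cond := near_expRN r0 cond.
near=> t; have t0 : 0 < t by near: t; apply: nbhs_pinfty_gt; exact: num_real.
have /andP[y0 y1] : 0 < expR (- (r * t)) < 1 by near: t.
have /(_ _)/wrap[//|condy] := near cond t.
set y := expR _ in y0 y1 condy *.
(* The limit says nothing about y beyond the total mass M, where the bound
   D t <= y is trivial. *)
have [My|yM] := ltP M y.
  apply: (@le_trans _ _ (mu setT)); last by rewrite muE lee_fin ltW.
  apply: le_measure; rewrite ?inE//.
  exact: (measurable_superlevel (measurable_exponent p)).
have := condy yM; rewrite subKr sub0r normrN ger0_norm ?powR_ge0//.
rewrite powR_q_le ?y0// => qy.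
apply: rearrangement_inv_lt => //; apply: lt_le_trans qy.
rewrite /y expRK opprK lte_fin invfM mulrA mulfK ?gt_eqF//.
by rewrite ltr_pMl ?invr_gt0// ltr1n.
Unshelve. all: by end_near. Qed.

End reciprocal_rearrangement.

(** * Bounded classes and their L2 pairing *)

Section Linfty_theory.
Context d (T : measurableType d) (R : realType).
Variable mu : {finite_measure set T -> \bar R}.
Local Notation L := (Linfty mu).
Implicit Types f g : L.

Lemma measurable_Linfty f : measurable_fun setT (f : T -> R).
Proof. exact: (measurable_funP (repr (Linfty_val f))). Qed.

(** The norm vanishes by definition on a null space, where every property holds
    almost everywhere. *)
Lemma Linfty_ae_le f : {ae mu, forall t, `|f t| <= `|f|}.
Proof.
have [mu0|mu0] := ltP 0%E (mu setT); last first.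
  exists setT; split => //.
  by apply/eqP; rewrite eq_le mu0 measure_ge0.
have := Linfty_normK f; rewrite unlock /Lnorm mu0 => fE.
have := ess_sup_ge mu (fun t => `|(EFin \o (f : T -> R)) t|%E); apply: filterS => t.
by rewrite -fE lee_fin.
Qed.

Lemma Linfty_norm_le f (c : R) : 0 <= c ->
  {ae mu, forall t, `|f t| <= c} -> `|f| <= c.
Proof.
move=> c0 fc; rewrite -lee_fin -[leLHS]/((Linfty_norm f)%:E) Linfty_normK.
rewrite unlock /Lnorm; case: ifPn => _; last by rewrite lee_fin.
by apply/ess_supP; apply: filterS fc => t; rewrite lee_fin.
Qed.

Lemma Linfty_linE (a : R) f g :
  ((a *: f + g : L) : T -> R) = (fun t => a * f t + g t) %[ae mu].
Proof.
apply: ae_eq_trans (L0_addE (a *: Linfty_val f) (Linfty_val g)) _.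
by apply: filterS (L0_scaleE a (Linfty_val f)) => t /= + _ => /(_ I) ->.
Qed.

Lemma Linfty_sumE (n : nat) (c : nat -> R) (e : nat -> L) :
  ((\sum_(i < n) c i *: e i : L) : T -> R) =
  (fun t => \sum_(i < n) c i * e i t) %[ae mu].
Proof.
elim: n => [|n ih].
  rewrite big_ord0; apply: ae_eq_trans (L0_zeroE mu) _.
  by apply: nearW => t _; rewrite big_ord0.
rewrite big_ord_recr/= addrC; apply: ae_eq_trans (Linfty_linE _ _ _) _.
by apply: filterS ih => t /= + _ => /(_ I) ->; rewrite big_ord_recr/= addrC.
Qed.

(** Classes are handled through the functions that they contain: existence of a
    class equal to g almost everywhere is all that is needed of g. *)
Lemma Linfty_of_bounded (g : T -> R) (c : R) : measurable_fun setT g ->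
  (forall t, `|g t| <= c) -> exists f, (f : T -> R) = g %[ae mu].
Proof.
move=> mg gc; pose u := mfun_Sub (mem_set mg : g \in mfun).
have uE : (L0_class mu u : T -> R) = g %[ae mu] by exact: L0_classE.
suff fin : L0_class mu u \in Linfty_pred (mu := mu) by exists (LinftyOf fin).
rewrite inE /= /finite_norm (Linfty_Lnorm_ae uE) unlock /Lnorm.
case: ifPn => _ //; apply: (@le_lt_trans _ _ c%:E); last exact: ltry.
by apply/ess_supP; apply: nearW => t; rewrite lee_fin.
Qed.

Lemma integrable_ae_bounded (h : T -> R) (c : R) : measurable_fun setT h ->
  {ae mu, forall t, `|h t| <= c} -> mu.-integrable setT (EFin \o h).
Proof.
move=> mh hc; apply/integrableP; split; first exact/measurable_EFinP.
have hc' : {ae mu, forall t, `|h t| <= `|c|}.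
  by apply: filterS hc => t /le_trans; apply; exact: ler_norm.
apply: (@le_lt_trans _ _ (\int[mu]_t (cst `|c|%:E) t)%E).
  apply: ae_ge0_le_integral => //.
  - by apply: measurableT_comp => //; exact/measurable_EFinP.
  - by move=> t _; rewrite lee_fin.
  - by apply: filterS hc' => t + _; rewrite lee_fin.
rewrite integral_cst//= lte_mul_pinfty ?lee_fin//.
exact: fin_num_fun_lty.
Qed.

Lemma integrable_LinftyM f g : mu.-integrable setT (EFin \o (fun t => f t * g t)).
Proof.
apply: (@integrable_ae_bounded _ (`|f| * `|g|)).
  by apply: measurable_funM; exact: measurable_Linfty.
apply: filterS2 (Linfty_ae_le f) (Linfty_ae_le g) => t ft gt.
by rewrite normrM ler_pM.
Qed.

Definition L2_pairing f g : R := \int[mu]_t (f t * g t).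

Lemma L2_pairingC f g : L2_pairing f g = L2_pairing g f.
Proof. by apply: eq_Rintegral => t _; rewrite mulrC. Qed.

Lemma L2_pairing_lin (a : R) f g h :
  L2_pairing (a *: f + g) h = a * L2_pairing f h + L2_pairing g h.
Proof.
rewrite /L2_pairing -RintegralZl//; last exact: integrable_LinftyM.
rewrite -RintegralD//; last 2 first.
- apply: (@integrable_ae_bounded _ (`|a| * (`|f| * `|h|))).
    apply: measurable_funM => //.
    by apply: measurable_funM; exact: measurable_Linfty.
  apply: filterS2 (Linfty_ae_le f) (Linfty_ae_le h) => t ft ht.
  by rewrite !normrM ler_wpM2l// ler_pM.
- exact: integrable_LinftyM.
rewrite /Rintegral; congr fine; apply: ae_eq_integral => //.
- by apply/measurable_EFinP; apply: measurable_funM; exact: measurable_Linfty.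
- apply/measurable_EFinP; apply: measurable_funD; last first.
    by apply: measurable_funM; exact: measurable_Linfty.
  apply: measurable_funM => //.
  by apply: measurable_funM; exact: measurable_Linfty.
- by apply: filterS (Linfty_linE a f g) => t /= /(_ I) -> _; rewrite mulrDl mulrA.
Qed.

Lemma L2_pairing0 h : L2_pairing 0 h = 0.
Proof. by have := L2_pairing_lin (-1) 0 0 h; rewrite scaler0 addr0 mulN1r addNr. Qed.

Lemma L2_pairing_suml (n : nat) (c : nat -> R) (e : nat -> L) h :
  L2_pairing (\sum_(i < n) c i *: e i) h = \sum_(i < n) c i * L2_pairing (e i) h.
Proof.
elim: n => [|n ih]; first by rewrite !big_ord0 L2_pairing0.
by rewrite !big_ord_recr/= addrC L2_pairing_lin ih addrC.
Qed.

Lemma L2_pairing_ge0 f : 0 <= L2_pairing f f.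
Proof. by apply: Rintegral_ge0 => t _; rewrite -expr2 sqr_ge0. Qed.

End Linfty_theory.

(** * Grothendieck's finite-dimensionality theorem *)

(** Almost everywhere statements can only be combined over countably many
    coefficient vectors, so real coefficients are replaced by these rational
    approximations. *)
Lemma floor_approx (R : realType) (a : R) :
  (Num.floor (n.+1%:R * a))%:~R / n.+1%:R @[n --> \oo] --> a.
Proof.
apply/cvgrPdist_le => e e0; near=> n.
have n0 : 0 < n.+1%:R :> R by [].
have /andP[fl fu] := floor_itv (n.+1%:R * a).
have le1 : `|n.+1%:R * a - (Num.floor (n.+1%:R * a))%:~R| <= 1.
  by rewrite intrD in fu; rewrite ger0_norm; lra.
rewrite -[X in X - _](mulKf (lt0r_neq0 n0)) mulrC -mulrBl normrM normfV.
rewrite [X in _ / X]gtr0_norm// (le_trans (ler_pM _ _ le1 (lexx _)))// mul1r.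
by apply: ltW; near: n; exact: (near_infty_natSinv_lt (PosNum e0)).
Unshelve. all: by end_near. Qed.

Lemma cvg_sumR (R : realType) (n : nat) (u : 'I_n -> nat -> R) (l : 'I_n -> R) :
  (forall i, u i N @[N --> \oo] --> l i) ->
  \sum_(i < n) u i N @[N --> \oo] --> \sum_(i < n) l i.
Proof. by move=> ul; apply: cvg_big => //; exact: add_continuous. Qed.

(** With w = a instead of an integer vector, the hypothesis would read
    S ^ 2 <= C S for S the sum of the squares.  By homogeneity it holds for
    rational vectors with a common denominator, and then for w = a in the
    limit. *)
Lemma sum_sqr_le (R : realType) (n : nat) (a : nat -> R) (C : R) : 0 <= C ->
  (forall z : {ffun 'I_n -> int},
     (\sum_(i < n) (z i)%:~R * a i) ^+ 2 <= C * \sum_(i < n) (z i)%:~R ^+ 2) ->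
  \sum_(i < n) a i ^+ 2 <= C.
Proof.
move=> C0 aC; set S := \sum_(i < n) _.
have S0 : 0 <= S by apply: sumr_ge0 => i _; exact: sqr_ge0.
pose w (i : 'I_n) (N : nat) : R := (Num.floor (N.+1%:R * a i))%:~R / N.+1%:R.
have wa i : w i N @[N --> \oo] --> a i by exact: floor_approx.
have wC N : (\sum_(i < n) w i N * a i) ^+ 2 <= C * \sum_(i < n) w i N ^+ 2.
  have := aC [ffun i : 'I_n => Num.floor (N.+1%:R * a i)].
  under eq_bigr do rewrite ffunE; under [X in _ <= C * X]eq_bigr do rewrite ffunE.
  have N2 : 0 < (N.+1%:R ^-1 : R) ^+ 2 by rewrite exprn_gt0// invr_gt0.
  rewrite -(ler_pM2l N2) -exprMn mulr_sumr mulrCA mulr_sumr.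
  have -> : \sum_(i < n) N.+1%:R^-1 * ((Num.floor (N.+1%:R * a i))%:~R * a i) =
      \sum_(i < n) w i N * a i.
    by apply: eq_bigr => i _; rewrite mulrA [X in X * _]mulrC.
  congr (_ <= C * _); apply: eq_bigr => i _.
  by rewrite -exprMn mulrC.
have S2 : S ^+ 2 <= C * S.
  have cvgl : (\sum_(i < n) w i N * a i) ^+ 2 @[N --> \oo] --> S ^+ 2.
    suff cvgS : \sum_(i < n) w i N * a i @[N --> \oo] --> S by exact: cvgM.
    by apply: cvg_sumR => i; rewrite expr2; apply: cvgM => //; exact: cvg_cst.
  have cvgr : C * \sum_(i < n) w i N ^+ 2 @[N --> \oo] --> C * S.
    apply: cvgM; first exact: cvg_cst.
    by apply: cvg_sumR => i; exact: cvgM.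
  rewrite -(cvg_lim _ cvgl)// -(cvg_lim _ cvgr)//; apply: ler_lim.
  - by apply/cvg_ex; eexists; exact: cvgl.
  - by apply/cvg_ex; eexists; exact: cvgr.
  by apply: nearW => N; exact: wC.
move: S0; rewrite le_eqVlt => /predU1P[<-//|Sgt0].
by move: S2; rewrite expr2 ler_pM2r.
Qed.

Section finite_dimension_of_L2_equivalence.
Context d (T : measurableType d) (R : realType).
Variable mu : {finite_measure set T -> \bar R}.
Local Notation L := (Linfty mu).
Local Notation M := (fine (mu setT)).
Variables (V : set L) (C : R).
Hypothesis linV : linear_subspace V.
Hypothesis C0 : 0 <= C.
Hypothesis VC : forall f, V f -> `|f| ^+ 2 <= C * L2_pairing f f.

(** Families are indexed by nat and only their first n members count, which makes
    it possible to extend them without changing the type of the index. *)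
Definition orthonormal (n : nat) (e : nat -> L) := forall i j, (i < n)%N ->
  (j < n)%N -> L2_pairing (e i) (e j) = (i == j)%:R.

Lemma subspace_sum (n : nat) (c : nat -> R) (e : nat -> L) :
  (forall i, (i < n)%N -> V (e i)) -> V (\sum_(i < n) c i *: e i).
Proof.
have [V0 Vlin] := linV; elim: n => [|n ih] Ve; first by rewrite big_ord0.
rewrite big_ord_recr/= addrC; apply: Vlin; first exact: Ve.
by apply: ih => i ni; apply: Ve; exact: ltnW.
Qed.

Let pairing_sum (n : nat) (c : nat -> R) (e : nat -> L) : orthonormal n e ->
  forall j, (j < n)%N -> L2_pairing (\sum_(i < n) c i *: e i) (e j) = c j.
Proof.
move=> on j jn; rewrite L2_pairing_suml (bigD1 (Ordinal jn))//= big1 => [|i ij].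
  by rewrite on// eqxx mulr1 addr0.
rewrite on//; case: eqP => [ijE|_]; last by rewrite mulr0.
by move/eqP: ij => []; apply: val_inj.
Qed.

Let pairing_sum_sqr (n : nat) (c : nat -> R) (e : nat -> L) : orthonormal n e ->
  let f := \sum_(i < n) c i *: e i in L2_pairing f f = \sum_(i < n) c i ^+ 2.
Proof.
move=> on f; rewrite {1}/f L2_pairing_suml; apply: eq_bigr => i _.
by rewrite L2_pairingC pairing_sum// expr2.
Qed.

(** Grothendieck's argument.  A combination with coefficients c has L2 norm |c|,
    hence its values at almost every point are at most sqrt C |c|.  Choosing c
    to be the vector of the values of the family at the point bounds the sum of
    their squares by C, and the integral of this sum is n. *)
Lemma orthonormal_bound (n : nat) (e : nat -> L) : orthonormal n e ->
  (forall i, (i < n)%N -> V (e i)) -> n%:R <= C * M.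
Proof.
move=> on Ve.
pose good (z : {ffun 'I_n -> int}) (t : T) :=
  (\sum_(i < n) (z i)%:~R * e i t) ^+ 2 <= C * \sum_(i < n) (z i)%:~R ^+ 2.
have ae_good z : {ae mu, forall t, good z t}.
  pose c (i : nat) : R := if insub i is Some j then (z j)%:~R else 0.
  have cE (i : 'I_n) : c i = (z i)%:~R by rewrite /c valK.
  pose f := \sum_(i < n) c i *: e i.
  apply: filterS2 (Linfty_ae_le f) (Linfty_sumE n c e) => t ft /(_ I) fE.
  rewrite /good; under eq_bigr do rewrite -cE.
  under [X in _ <= C * X]eq_bigr do rewrite -cE.
  rewrite -(pairing_sum_sqr c on) (le_trans _ (VC (subspace_sum c Ve)))//.
  rewrite -[leLHS]real_normK ?num_real// lerXn2r ?nnegrE//.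
  by rewrite -[X in `|X|]fE.
have {}ae_good : {ae mu, forall t z, good z t}.
  (* Countably many integer vectors, enumerated by their codes. *)
  pose P k t := if unpickle k is Some z then good z t else true.
  have : {ae mu, forall t k, P k t}.
    apply: ae_foralln => k; rewrite /P; case: unpickle => [z|]; first exact: ae_good.
    by apply: nearW.
  by apply: filterS => t Pt z; have := Pt (pickle z); rewrite /P pickleK.
have ae_le : {ae mu, forall t, \sum_(i < n) e i t ^+ 2 <= C}.
  by apply: filterS ae_good => t gt; exact: (@sum_sqr_le _ n (fun i => e i t)).
have me (i : 'I_n) : measurable_fun setT (fun t => (e i t ^+ 2)%:E).
  by apply/measurable_EFinP; apply: measurable_funX; exact: measurable_Linfty.
rewrite -lee_fin EFinM fineK ?fin_num_measure// -(integral_cst mu measurableT).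
have -> : n%:R%:E = (\sum_(i < n) \int[mu]_t (e i t ^+ 2)%:E)%E.
  rewrite (eq_bigr (fun=> 1%:E)) ?sumEFin ?sumr_const ?card_ord// => i _.
  have <- : L2_pairing (e i) (e i) = 1 by rewrite on// eqxx.
  rewrite /L2_pairing /Rintegral fineK; last exact/integrable_fin_num/integrable_LinftyM.
  by apply: eq_integral => t _; rewrite expr2.
rewrite -ge0_integral_sum//; last by move=> i t _; rewrite lee_fin sqr_ge0.
apply: ae_ge0_le_integral => //.
- by move=> t _; apply: sume_ge0 => i _; rewrite lee_fin sqr_ge0.
- exact: emeasurable_sum.
- by apply: filterS ae_le => t tC _; rewrite sumEFin lee_fin.
Qed.

(** One Gram-Schmidt step.  The new vector has nonzero L2 norm because, on V, the
    uniform norm is controlled by the L2 norm. *)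
Lemma orthonormal_extend (n : nat) (e : nat -> L) : ~ finite_dimensional V ->
  orthonormal n e -> (forall i, (i < n)%N -> V (e i)) ->
  exists e' : nat -> L, orthonormal n.+1 e' /\ forall i, (i < n.+1)%N -> V (e' i).
Proof.
move=> infV on Ve; have [V0 Vlin] := linV.
have [f Vf fspan] : exists2 f, V f & forall c : nat -> R, f <> \sum_(i < n) c i *: e i.
  apply: contrapT => noext; apply: infV; exists n, (fun i : 'I_n => e i).
  apply/seteqP; split=> f.
    move=> Vf; apply: contrapT => fspan; apply: noext; exists f => // c fE.
    by apply: fspan; exists (fun i : 'I_n => c i).
  move=> [c _ <-]; pose c' (i : nat) : R := if insub i is Some j then c j else 0.
  rewrite (eq_bigr (fun i : 'I_n => c' i *: e i)); first exact: subspace_sum.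
  by move=> i _; rewrite /c' valK.
pose c i := L2_pairing f (e i); pose g := (-1) *: (\sum_(i < n) c i *: e i) + f.
have Vg : V g by apply: Vlin => //; exact: subspace_sum.
have g0 : g <> 0.
  move=> g0; apply: (fspan c); apply/eqP; rewrite -subr_eq0; apply/eqP.
  by rewrite -[RHS]g0 /g scaleN1r addrC.
have gg0 : 0 < L2_pairing g g.
  rewrite lt_neqAle L2_pairing_ge0 andbT; apply/eqP => gg0.
  apply: g0; apply/eqP; rewrite -normr_eq0 -sqrf_eq0 eq_le sqr_ge0 andbT.
  by rewrite (le_trans (VC Vg))// -gg0 mulr0.
have ge j : (j < n)%N -> L2_pairing g (e j) = 0.
  by move=> jn; rewrite /g L2_pairing_lin pairing_sum// mulN1r addNr.
pose s := (Num.sqrt (L2_pairing g g))^-1; pose h := s *: g + 0.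
have Vh : V h by exact: Vlin.
have he j : (j < n)%N -> L2_pairing h (e j) = 0.
  by move=> jn; rewrite /h L2_pairing_lin ge// mulr0 L2_pairing0 addr0.
have hh : L2_pairing h h = 1.
  rewrite /h L2_pairing_lin L2_pairing0 addr0 L2_pairingC L2_pairing_lin.
  rewrite L2_pairing0 addr0 mulrA -expr2 /s exprVn sqr_sqrtr ?(ltW gg0)//.
  by rewrite mulVf// gt_eqF.
exists (fun i => if i == n then h else e i); split; last first.
  by move=> i; rewrite ltnS leq_eqVlt; case: eqP => //= _; exact: Ve.
move=> i j; rewrite (ltnS i) (leq_eqVlt i) (ltnS j) (leq_eqVlt j).
case: (eqVneq i n) => [->|ni] /=; case: (eqVneq j n) => [->|nj] //=.
- by move=> _ jn; rewrite he.
- by move=> jn _; rewrite L2_pairingC he// (negPf ni).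
- exact: on.
Qed.

Lemma finite_dimensional_L2 : finite_dimensional V.
Proof.
apply: contrapT => infV.
have ex n : exists e, orthonormal n e /\ forall i, (i < n)%N -> V (e i).
  elim: n => [|n [e [on Ve]]]; first by exists (fun=> 0).
  exact: orthonormal_extend on Ve.
have [e [on Ve]] := ex (Num.truncn (C * M)).+1.
have := orthonormal_bound on Ve; rewrite leNgt => /negP; apply.
have CM : 0 <= C * M by rewrite mulr_ge0// fine_ge0.
by have /andP[] := truncn_itv CM.
Qed.

End finite_dimension_of_L2_equivalence.

(** * Strict singularity from exponential integrability *)

Section isomorphisms_onto_the_image.
Variables (R : realType) (E F : normedModType R) (f : {linear E -> F}) (V : set E).
Hypothesis linV : linear_subspace V.

Let subV x y : V x -> V y -> V (x - y).
Proof.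
move=> Vx Vy; rewrite addrC -scaleN1r; have [_ Vlin] := linV; exact: Vlin.
Qed.

Let scaleV a x : V x -> V (a *: x).
Proof. by move=> Vx; have [V0 Vlin] := linV; rewrite -[_ *: _]addr0; exact: Vlin. Qed.

(** Continuity at 0 of the inverse, made quantitative by homogeneity. *)
Lemma isomorphism_on_lower_bound : isomorphism_on V f ->
  exists2 K : R, 0 < K & forall x, V x -> `|x| <= K * `|f x|.
Proof.
move=> [_ [g [/subspace_continuousP gcont gK]]]; have [V0 _] := linV.
have fV0 : (f @` V) 0 by exists 0 => //; rewrite linear0.
have g0 : g 0 = 0 by rewrite -[X in g X](linear0 f) gK.
have /nbhs_normP[e /= e0 eP] :
    nbhs (0 : F) (fun y => (f @` V) y -> `|g 0 - g y| < 1).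
  by have /cvgrPdist_lt/(_ 1 ltr01) := gcont 0 fV0.
exists (2 / e); first by rewrite divr_gt0.
move=> x Vx; have [fx0|fx0] := eqVneq `|f x| 0.
  move/eqP: fx0; rewrite normr_eq0 => /eqP fx0.
  have -> : x = 0 by rewrite -(gK x Vx) fx0 g0.
  by rewrite normr0 mulr_ge0// ltW// divr_gt0.
have fxgt0 : 0 < `|f x| by rewrite lt_neqAle eq_sym fx0 normr_ge0.
pose a := e / (2 * `|f x|).
have a0 : 0 < a by rewrite divr_gt0// mulr_gt0.
have afx : `|f (a *: x)| < e.
  by rewrite linearZ/= normrZ gtr0_norm// /a invfM mulrA mulfVK//; lra.
have := eP (f (a *: x)); rewrite /ball_ /= sub0r normrN => /(_ afx) /(_ _)/wrap[|].
  by exists (a *: x) => //; exact: scaleV.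
rewrite g0 sub0r normrN gK; last exact: scaleV.
rewrite normrZ gtr0_norm// => /ltW; rewrite -ler_pdivlMl// mulr1.
by rewrite /a invf_div mulrAC.
Qed.

(** The inverse has to be a total function: it takes the value 0 outside the image
    of V, and it is Lipschitz on this image. *)
Lemma isomorphism_on_bounds (C K : R) : (forall x, `|f x| <= C * `|x|) ->
  (forall x, V x -> `|x| <= K * `|f x|) -> isomorphism_on V f.
Proof.
move=> fC fK; have lip (G H : normedModType R) (S : set G) (h : G -> H) (k : R) :
    (forall x y, S x -> S y -> `|h x - h y| <= k * `|x - y|) ->
    {within S, continuous h}.
  move=> hk; apply/subspace_continuousP => x Sx; apply/cvgrPdist_lt => e e0.
  have k0 : 0 < `|k| + 1 by rewrite ltr_wpDl.
  suff : nbhs x (fun y => S y -> `|h x - h y| < e) by [].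
  apply/nbhs_normP; exists (e / (`|k| + 1)) => /=; first by rewrite divr_gt0.
  move=> y; rewrite /ball_ /= ltr_pdivlMr// => xy Sy.
  apply: le_lt_trans xy; rewrite mulrC (le_trans (hk _ _ Sx Sy))//.
  by rewrite ler_wpM2r// (le_trans (ler_norm _))// lerDl.
split.
  by apply: (lip _ _ _ _ C) => x y _ _; rewrite -linearB.
pose g y := xget 0 [set x | V x /\ f x = y].
have gP x : V x -> g (f x) = x.
  move=> Vx; rewrite /g; case: xgetP => [x' _ [Vx' fxx']|/(_ x)]; last by case.
  apply/eqP; rewrite -subr_eq0 -normr_le0.
  rewrite (le_trans (fK _ (subV Vx' Vx)))// linearB/= fxx' subrr.
  by rewrite normr0 mulr0.
exists g; split => //; apply: (lip _ _ _ _ K) => _ _ [x Vx <-] [y Vy <-].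
rewrite !gP// -linearB; exact/fK/subV.
Qed.

End isomorphisms_onto_the_image.

Section inclusion_of_Linfty.
Context d (T : measurableType d) (R : realType).
Variables (mu : {finite_measure set T -> \bar R}) (p : exponent T R).
Local Notation L := (Linfty mu).
Local Notation M := (fine (mu setT)).
Implicit Types f : L.

Let p_ge1 t : 1 <= p t. Proof. exact: exponent_ge1. Qed.

Lemma norm_inclusion f : `|inclusion mu p f| = luxemburg_norm mu p f.
Proof. by []. Qed.

Lemma powR_le_base (a q : R) : 0 <= a <= 1 -> 1 <= q -> a `^ q <= a.
Proof.
move=> /andP[a0 a1] q1; rewrite -[leRHS]powRr1//.
have [->|an0] := eqVneq a 0.
  by rewrite !powR0 ?oner_eq0// gt_eqF// (lt_le_trans ltr01).
by rewrite ger_powR// a1 andbT lt_neqAle eq_sym an0.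
Qed.

(** For values in [0, 1], raising to a power at least 1 only decreases them. *)
Lemma modular_le (f : T -> R) (a : R) : measurable_fun setT f -> 0 <= a <= 1 ->
  {ae mu, forall t, `|f t| <= a} -> (modular mu p f <= (a * M)%:E)%E.
Proof.
move=> mf /andP[a0 a1] fa; rewrite EFinM fineK ?fin_num_measure//.
rewrite -(integral_cst mu measurableT); apply: ae_ge0_le_integral => //.
- exact: measurable_modular.
- apply: filterS fa => t fta _; rewrite lee_fin.
  apply: le_trans (fta); apply: powR_le_base => //.
  by rewrite normr_ge0 (le_trans fta).
Qed.

Lemma norm_inclusion_le f : `|inclusion mu p f| <= Num.max 1 M * `|f|.
Proof.
rewrite norm_inclusion; set c := Num.max 1 M.
have c1 : 1 <= c by rewrite le_max lexx.
have c0 : 0 < c by rewrite (lt_le_trans ltr01).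
have [->|fn0] := eqVneq f 0.
  by rewrite normr0 mulr0 -norm_inclusion linear0 normr0.
have f0 : 0 < `|f| by rewrite normr_gt0.
apply: luxemburg_norm_le; split; first by rewrite mulr_gt0.
have cM : c^-1 * M <= 1.
  by rewrite ler_pdivrMl// mulr1 le_max lexx orbT.
apply: le_trans (_ : (c^-1 * M)%:E <= _)%E; last by rewrite lee_fin.
apply: modular_le.
- by apply: measurable_funM => //; exact: measurable_Linfty.
- by rewrite invr_ge0 (ltW c0) invf_le1.
- apply: filterS (Linfty_ae_le f) => t ft.
  have cf0 : 0 < c * `|f| by rewrite mulr_gt0.
  rewrite normrM normfV (gtr0_norm cf0) ler_pdivrMr//.
  by rewrite mulrA mulVf ?gt_eqF// mul1r.
Qed.

(** The norm is at least 1 / K, so 1 / (2 K) is not admissible in the infimum that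
    defines it. *)
Lemma modular_gt1 f (K : R) : 0 < K -> 1 <= K * `|inclusion mu p f| ->
  (1 < modular mu p (fun t => f t * (2 * K))%R)%E.
Proof.
move=> K0 Kf; rewrite ltNge; apply/negP => mod1.
have K2 : 0 < 2 * K by rewrite mulr_gt0.
have : luxemburg_norm mu p f <= (2 * K)^-1.
  apply: luxemburg_norm_le; split; first by rewrite invr_gt0.
  by rewrite invrK.
rewrite -norm_inclusion -(ler_pM2l K0) => /(le_trans Kf).
by rewrite invfM mulrCA divff ?gt_eqF// mulr1; lra.
Qed.

Lemma Lexp0_integrable_powR (K : R) : Lexp0 mu p -> 1 <= K ->
  mu.-integrable setT (EFin \o (fun t => K `^ p t)).
Proof.
move=> [mp pexp] K1; have K0 : 0 < K by rewrite (lt_le_trans ltr01).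
have KE t : K `^ p t = expR (ln K * p t) by rewrite /powR gt_eqF// mulrC.
apply/integrableP; split.
  apply/measurable_EFinP.
  rewrite (_ : (fun _ => _) = expR \o (fun t => ln K * p t)); last first.
    by apply/funext => t; rewrite KE.
  by apply: measurableT_comp => //; exact: measurable_funM.
have [->|Kn1] := eqVneq K 1.
  under eq_integral do rewrite /= powR1 normr1.
  by rewrite integral_cst// mul1e fin_num_fun_lty.
have /pexp : 0 < ln K by rewrite ln_gt0// lt_neqAle eq_sym Kn1.
move=> fin; rewrite (eq_integral (fun t => (expR `|ln K * p t|)%:E))// => t _ /=.
rewrite KE gtr0_norm ?expR_gt0// ger0_norm// mulr_ge0 ?ln_ge0//.
by rewrite (le_trans ler01).
Qed.

(** For f of uniform norm 1, put k = 2 K and split at |f| = dl, where k dl = b.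
    Where |f| <= dl, the integrand (k |f|)^p of the modular is at most b, which is
    so small that this part contributes at most 1/2.  Elsewhere it is at most
    k^p, and since the modular exceeds 1, the integral of k^p over the set
    |f| > dl is at least 1/2.  By absolute continuity this set has measure at
    least some h depending on k only, so the integral of f^2 is at least
    dl^2 h. *)
Lemma Lexp0_L2_lower_bound (K : R) : Lexp0 mu p -> 1 <= K ->
  exists2 C : R, 0 <= C & forall f, `|f| <= K * `|inclusion mu p f| ->
    `|f| ^+ 2 <= C * L2_pairing f f.
Proof.
move=> pexp K1; have K0 : 0 < K by rewrite (lt_le_trans ltr01).
pose k := 2 * K; have k1 : 1 <= k by rewrite /k; lra.
have k0 : 0 < k by rewrite (lt_le_trans ltr01).
have kint := Lexp0_integrable_powR pexp k1.
have half0 : 0 < 2^-1 :> R by rewrite invr_gt0.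
have [h [h0 hP]] := integral_normr_continuous kint half0.
pose c := Num.max 1 M; have c1 : 1 <= c by rewrite le_max lexx.
have c0 : 0 < c by rewrite (lt_le_trans ltr01).
pose b := (2 * c)^-1; have b0 : 0 < b by rewrite invr_gt0 mulr_gt0.
have b1 : b <= 1 by rewrite invf_le1 ?mulr_gt0//; lra.
have bM : b * M <= 2^-1.
  rewrite /b invfM -mulrA ler_piMr ?(ltW half0)// ler_pdivrMl// mulr1.
  by rewrite le_max lexx orbT.
pose dl := b / k; have dl0 : 0 < dl by rewrite divr_gt0.
suff main f : `|f| = 1 -> 1 <= K * `|inclusion mu p f| ->
    dl ^+ 2 * h <= L2_pairing f f.
  have C0 : 0 < dl ^+ 2 * h by rewrite mulr_gt0// exprn_gt0.
  exists (dl ^+ 2 * h)^-1; first by rewrite invr_ge0 ltW.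
  move=> f fK; have [->|fn0] := eqVneq f 0.
    by rewrite normr0 expr0n/= L2_pairing0 mulr0.
  have f0 : 0 < `|f| by rewrite normr_gt0.
  pose g := `|f|^-1 *: f + 0.
  have gn : `|g| = 1.
    by rewrite /g addr0 normrZ gtr0_norm ?invr_gt0// mulVf// gt_eqF.
  have gK : 1 <= K * `|inclusion mu p g|.
    rewrite /g addr0 linearZ/= normrZ gtr0_norm ?invr_gt0// mulrCA.
    by rewrite ler_pdivlMl// mulr1.
  have := main g gn gK; rewrite /g L2_pairing_lin L2_pairing0 addr0 L2_pairingC.
  rewrite L2_pairing_lin L2_pairing0 addr0 mulrA -expr2 exprVn.
  by rewrite ler_pdivlMl ?exprn_gt0// => H; rewrite ler_pdivlMl// mulrC.
move=> fn fK; have := modular_gt1 K0 fK; rewrite -/k => mod1.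
pose A := [set t | dl < `|f t|].
have mA : measurable A := measurable_superlevel (measurable_Linfty f) dl.
have fae : {ae mu, forall t, `|f t| <= 1}.
  by have := Linfty_ae_le f; rewrite fn.
have mfk : measurable_fun setT (fun t => (`|f t * k| `^ p t)%:E).
  by apply: measurable_modular; apply: measurable_funM => //; exact: measurable_Linfty.
have small : (\int[mu]_(t in ~` A) (`|f t * k| `^ p t)%:E <= (2^-1)%:E)%E.
  apply: (@le_trans _ _ (b * M)%:E); last by rewrite lee_fin.
  apply: (@le_trans _ _ (\int[mu]_(t in ~` A) cst b%:E t)%E).
    apply: ge0_le_integral => //; first exact: measurableC.
    - exact: measurable_funTS.
    - move=> t /= /negP; rewrite -leNgt => ft.
      have fkb : `|f t * k| <= b by rewrite normrM (gtr0_norm k0) -ler_pdivlMr.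
      rewrite lee_fin (le_trans _ fkb)// powR_le_base// normr_ge0/=.
      exact: le_trans b1.
  rewrite integral_cst; last exact: measurableC.
  rewrite EFinM lee_pmul2l// fineK ?fin_num_measure//.
  by apply: le_measure; rewrite ?inE//; exact: measurableC.
have large : (\int[mu]_(t in A) (`|f t * k| `^ p t)%:E <=
    \int[mu]_(t in A) (k `^ p t)%:E)%E.
  apply: ae_ge0_le_integral => //.
  - exact: measurable_funTS.
  - by move=> t _; rewrite lee_fin powR_ge0.
  - by apply: measurable_funTS; case/integrableP : kint.
  - apply: filterS fae => t ft _; rewrite lee_fin ge0_ler_powR ?nnegrE//.
    + by rewrite (le_trans ler01).
    + exact: ltW.
    by rewrite normrM (gtr0_norm k0) ler_piMl// ltW.
(* Otherwise k^p would integrate to less than 1/2 over A. *)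
have muA : (h%:E <= mu A)%E.
  rewrite leNgt; apply/negP => /(hP _ mA); apply/negP; rewrite -leNgt.
  have iA : mu.-integrable A (EFin \o (fun t => k `^ p t)).
    exact: integrableS kint.
  rewrite -lee_fin /Rintegral.
  under eq_integral do rewrite ger0_norm ?powR_ge0//.
  rewrite fineK; last exact: integrable_fin_num iA.
  move: mod1; rewrite /modular -(setUv A) ge0_integral_setU//; last 3 first.
  - exact: measurableC.
  - by rewrite setUv.
  - by rewrite disj_set2E setICr.
  move=> mod1; have := lt_le_trans mod1 (leeD large small).
  move: (integrable_fin_num mA iA) => /fineK <-.
  by rewrite -EFinD lte_fin lee_fin; lra.
have fAfin : mu A \is a fin_num by rewrite fin_num_measure.
rewrite -lee_fin /L2_pairing /Rintegral fineK; last first.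
  exact/integrable_fin_num/integrable_LinftyM.
apply: (@le_trans _ _ (\int[mu]_(t in A) cst (dl ^+ 2)%:E t)%E).
  by rewrite integral_cst// EFinM lee_pmul2l// lte_fin exprn_gt0.
have mff : measurable_fun setT (fun t => (f t * f t)%:E).
  by apply/measurable_EFinP; apply: measurable_funM; exact: measurable_Linfty.
apply: (@le_trans _ _ (\int[mu]_(t in A) (f t * f t)%:E)%E).
  apply: ge0_le_integral => //.
  - by move=> t _; rewrite lee_fin sqr_ge0.
  - exact: measurable_funTS.
  - move=> t /= dt; rewrite lee_fin -expr2 -[leRHS]real_normK ?num_real//.
    by rewrite lerXn2r ?nnegrE ?(ltW dl0)// ltW.
by apply: ge0_subset_integral => // t _; rewrite lee_fin -expr2 sqr_ge0.
Qed.

Lemma Lexp0_strictly_singular : Lexp0 mu p ->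
  strictly_singular (inclusion mu p : {linear L -> varLp mu p}).
Proof.
move=> pexp [V [linV _ infV isoV]]; apply: infV.
have [K K0 VK] := isomorphism_on_lower_bound linV isoV.
have K1 : 1 <= Num.max 1 K by rewrite le_max lexx.
have [C C0 VC] := Lexp0_L2_lower_bound pexp K1.
apply: (finite_dimensional_L2 linV C0) => f Vf; apply: VC.
rewrite (le_trans (VK f Vf))// ler_wpM2r//.
by rewrite le_max lexx orbT.
Qed.

End inclusion_of_Linfty.

(** * Blockwise constant functions *)

Section blockwise_constant_functions.
Context d (T : measurableType d) (R : realType).
Variables (mu : {finite_measure set T -> \bar R}) (p : exponent T R).
Local Notation L := (Linfty mu).
Variables (r : R) (block : T -> nat).
Hypothesis r0 : 0 < r.
Hypothesis mblock : forall k, measurable [set u | block u = k].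
(** On B the function exp r ^ p is at least exp (r t), so its integral over each
    block is greater than 1. *)
Hypothesis large_block : forall k, exists (B : set T) (t : R), [/\ measurable B,
  forall u, B u -> block u = k, 0 <= t, forall u, B u -> t <= p u &
  ((expR (- (r * t)))%:E < mu B)%E].

Definition blockwise_constant : set L :=
  [set f | forall k, exists a : R, {ae mu, forall u, block u = k -> f u = a}].

Lemma blockwise_constant_linear : linear_subspace blockwise_constant.
Proof.
split=> [k|a f g Vf Vg k].
  by exists 0; apply: filterS (L0_zeroE mu) => u /= /(_ I).
have [[b fb] [c gc]] := (Vf k, Vg k); exists (a * b + c).
apply: filterS3 fb gc (Linfty_linE a f g) => u fu gu /(_ I) -> uk.
by rewrite fu// gu.
Qed.

(** A limit f is within 1 / (n + 1) of some constant on the block, for all n at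
    once off a null set.  Any two values of f at points of the block outside that
    null set then coincide. *)
Lemma blockwise_constant_closed : closed blockwise_constant.
Proof.
move=> f clf k.
have approx n : exists a : R,
    {ae mu, forall u, block u = k -> `|f u - a| <= n.+1%:R^-1}.
  have n0 : 0 < n.+1%:R^-1 :> R by rewrite invr_gt0.
  have [g [Vg]] := clf _ (nbhsx_ballx f _ n0).
  rewrite -ball_normE /ball_/= => fg.
  have [a ga] := Vg k; exists a.
  have sub := Linfty_linE (-1) g f.
  apply: filterS3 ga sub (Linfty_ae_le (-1 *: g + f)) => u gu /(_ I) -> fgu uk.
  rewrite -(gu uk) addrC -mulN1r (le_trans fgu)// scaleN1r addrC.
  exact: ltW.
have [a fa] := choice approx.
have {fa} := ae_foralln fa.
move=> fa; have [[u0 [u0k fu0]]|no] := pselect (exists u0, block u0 = k /\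
    forall n, block u0 = k -> `|f u0 - a n| <= n.+1%:R^-1); last first.
  exists 0; apply: filterS fa => u fu uk; exfalso; apply: no.
  by exists u.
(* A single good point of the block provides the constant. *)
exists (f u0); apply: filterS fa => u fu uk.
apply/eqP; rewrite -subr_eq0 -normr_le0; apply/ler_addgt0Pl => e e0; rewrite addr0.
have e2 : 0 < e / 2 by rewrite divr_gt0.
have [n _ /(_ n (leqnn n)) ne] := near_infty_natSinv_lt (PosNum e2).
have {}ne : n.+1%:R^-1 < e / 2 := ne.
rewrite -(subrKA (a n)) (le_trans (ler_normD _ _))//.
rewrite [X in _ + X <= _]distrC.
by rewrite (splitr e) lerD// (le_trans _ (ltW ne))//; [exact: fu|exact: fu0].
Qed.

Let mu_block k : (0 < mu [set u | block u = k])%E.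
Proof.
have [B [t [mB Bk t0 Bt muB]]] := large_block k.
apply: (@lt_le_trans _ _ (mu B)).
  by apply: le_lt_trans muB; rewrite lee_fin expR_ge0.
by apply: le_measure; rewrite ?inE.
Qed.

(** The indicators of n + 1 blocks in a space spanned by n vectors satisfy a
    nontrivial linear relation, and evaluating it on the blocks, which have
    positive measure, shows that its coefficients vanish. *)
Lemma blockwise_constant_infinite : ~ finite_dimensional blockwise_constant.
Proof.
move=> [n [e Ve]].
have indic k : exists f : L, (f : T -> R) = \1_[set u | block u = k] %[ae mu].
  apply: (@Linfty_of_bounded _ _ _ _ _ 1).
    exact: measurable_indic.
  by move=> u; rewrite indicE; case: (_ \in _); rewrite ?normr1 ?normr0.
have [F FE] := choice indic.
have VF k : blockwise_constant (F k).
  move=> j; exists (j == k)%:R; apply: filterS (FE k) => u /= /(_ I) -> uj.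
  by rewrite indicE; congr (nat_of_bool _)%:R; apply/idP/eqP;
    rewrite inE/= uj.
have coef k : exists c : 'I_n -> R, \sum_(i < n) c i *: e i = F k.
  by have := VF k; rewrite Ve => -[c _ cF]; exists c.
have [c cE] := choice coef.
pose A : 'M[R]_(n.+1, n) := \matrix_(k, i) c k i.
have /rowV0Pn[v /sub_kermxP vA v0] : kermx A != 0.
  by rewrite kermx_eq0 -row_leq_rank -ltnNge ltnS rank_leq_col.
pose w (k : nat) : R := if insub k is Some j then v 0 j else 0.
have wE (k : 'I_n.+1) : w k = v 0 k by rewrite /w valK.
have sum0 : \sum_(k < n.+1) w k *: F k = 0.
  under eq_bigr do rewrite -cE scaler_sumr.
  rewrite exchange_big/= big1// => i _.
  under eq_bigr do rewrite scalerA.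
  rewrite -scaler_suml (_ : \sum_(k < n.+1) _ = (v *m A) 0 i).
    by rewrite vA mxE scale0r.
  by rewrite mxE; apply: eq_bigr => k _; rewrite wE mxE.
have FEall := ae_foralln FE.
have sumE := Linfty_sumE n.+1 w F; rewrite sum0 in sumE.
case/eqP : v0; apply/rowP => j; rewrite mxE -wE; apply: contrapT => wj.
have [N [mN muN subN]] : {ae mu, forall u, block u <> j}.
  apply: filterS3 FEall sumE (L0_zeroE mu) => u Fu /(_ I) su /(_ I) zu uj.
  apply: wj; rewrite -[RHS]zu; rewrite [RHS]su.
  rewrite (bigD1 j)//= big1 => [|k kj]; rewrite Fu//= indicE.
    by rewrite mem_set ?mulr1 ?addr0.
  rewrite memNset ?mulr0//= uj => jk; move/eqP: kj; apply.
  exact/val_inj/esym.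
have := mu_block j; rewrite lt_neqAle eq_sym => /andP[/eqP muj _]; apply: muj.
apply/eqP; rewrite eq_le measure_ge0 andbT -muN.
by apply: le_measure; rewrite ?inE// => u uj; apply: subN => /=; exact.
Qed.

(** If |a| / s were greater than exp r, the modular of f / s over the block would
    already exceed 1. *)
Lemma block_norm_le (f : L) (k : nat) (a : R) :
  {ae mu, forall u, block u = k -> f u = a} ->
  `|a| <= expR r * `|inclusion mu p f|.
Proof.
move=> fa; have [B [t [mB Bk t0 Bt muB]]] := large_block k.
rewrite mulrC -ler_pdivrMr ?expR_gt0// norm_inclusion.
apply: lb_le_inf.
  apply: luxemburg_set_nonempty; first exact: measurable_Linfty.
  exact: (varLp_finite (inclusion mu p f)).
move=> s [s0 mod1]; rewrite leNgt; apply/negP => sa.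
suff : (1 < modular mu p (fun u => f u / s)%R)%E by rewrite ltNge mod1.
have mfs : measurable_fun setT (fun u => (`|f u / s| `^ p u)%:E).
  by apply: measurable_modular; apply: measurable_funM => //; exact: measurable_Linfty.
apply: (@lt_le_trans _ _ (\int[mu]_(u in B) cst (expR (r * t))%:E u)%E).
  rewrite integral_cst// muleC -lte_pdivrMr ?expR_gt0//.
  by rewrite mul1e -expRN.
apply: (@le_trans _ _ (\int[mu]_(u in B) (`|f u / s| `^ p u)%:E)%E); last first.
  exact: ge0_subset_integral.
apply: ae_ge0_le_integral => //.
- by move=> u _; rewrite lee_fin expR_ge0.
- exact: measurable_funTS.
- apply: filterS fa => u fu Bu; rewrite lee_fin fu; last exact: Bk.
  have as_ge : expR r <= `|a / s|.
    rewrite normrM normfV (gtr0_norm s0) ler_pdivlMr// mulrC -ler_pdivlMr ?expR_gt0//.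
    exact: ltW.
  apply: (@le_trans _ _ (expR r `^ p u)).
    by rewrite /powR gt_eqF ?expR_gt0// expRK ler_expR mulrC ler_pM2r// Bt.
  rewrite ge0_ler_powR ?nnegrE ?expR_ge0//.
  exact: le_trans ler01 (exponent_ge1 _ _).
Qed.

Lemma blockwise_constant_isomorphism :
  isomorphism_on blockwise_constant (inclusion mu p : {linear L -> varLp mu p}).
Proof.
apply: (@isomorphism_on_bounds _ _ _ _ _ blockwise_constant_linear
  (Num.max 1 (fine (mu setT))) (expR r)); first exact: norm_inclusion_le.
move=> f Vf; apply: Linfty_norm_le; first by rewrite mulr_ge0 ?expR_ge0.
have : {ae mu, forall u k, block u = k -> `|f u| <= expR r * `|inclusion mu p f|}.
  apply: ae_foralln => k; have [a fa] := Vf k.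
  by apply: filterS (fa) => u fu uk; rewrite fu//; exact: block_norm_le fa.
by apply: filterS => u fu; exact: fu.
Qed.

End blockwise_constant_functions.

Section strictly_singular_tail.
Context d (T : measurableType d) (R : realType).
Variables (mu : {finite_measure set T -> \bar R}) (p : exponent T R).
Local Notation D := (distribution_function mu p).

Let p_gt0 u : 0 < p u. Proof. exact: lt_le_trans (exponent_ge1 p u). Qed.

Let measurable_le (c : R) : measurable [set u | p u <= c].
Proof.
rewrite [X in measurable X](_ : _ = setT `&` p @^-1` `]-oo, c]); last first.
  by rewrite setTI; apply/seteqP; split=> u /=; rewrite in_itv.
by apply: measurable_exponent => //; exact: measurable_itv.
Qed.

Local Notation band t m := ([set u | t < `|p u|] `&` [set u | p u <= m%:R]).

(** Continuity from below of the measure: a large enough truncation level keeps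
    more than c of the mass. *)
Lemma superlevel_cut (t c : R) : (c%:E < D t)%E ->
  exists m0 : nat, forall m : nat, (m0 <= m)%N ->
    (c%:E < mu (band t m))%E.
Proof.
move=> cD; pose F m := band t m.
have mF m : measurable (F m).
  by apply: measurableI => //; exact: (measurable_superlevel (measurable_exponent p)).
have ndF : {homo F : n m / (n <= m)%N >-> (n <= m)%O}.
  move=> n m nm; apply/subsetPset => u [tu un]; split => //=.
  by rewrite (le_trans un)// ler_nat.
have FE : \bigcup_m F m = [set u | t < `|p u|].
  apply/seteqP; split=> [u [m _ []]//|u tu].
  exists (Num.truncn (p u)).+1 => //; split => //=.
  by have /andP[_ /ltW] := truncn_itv (ltW (p_gt0 u)).
have := nondecreasing_cvg_mu (mu := mu) mF (bigcupT_measurable F mF) ndF.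
rewrite FE => Fcvg.
have [m cm] : exists m, (c%:E < mu (F m))%E.
  apply: contrapT => no; move: cD; rewrite ltNge => /negP; apply.
  rewrite /distribution_function -(cvg_lim _ Fcvg)//; apply: lime_le.
    by apply/cvg_ex; eexists; exact: Fcvg.
  apply: nearW => m /=; rewrite leNgt; apply/negP => cm; apply: no.
  by exists m.
exists m => m' mm'; apply: (lt_le_trans cm).
apply: le_measure; rewrite ?inE; [exact: mF|exact: (mF m')|].
exact/subsetPset/(ndF _ _ mm').
Qed.

(** Since the decay fails at the rate r beyond every threshold, from each integer
    level c one can reach another level m such that the band c < p <= m contains
    a set of points with p > t, for some t > c, of measure greater than
    exp (- r t).  Iterating from 0 cuts the space into bands, and the block of a
    point is the index of its band. *)
Lemma not_tail_blocks : ~ superexponential_tail mu p ->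
  exists (r : R) (block : T -> nat), [/\ 0 < r,
    forall k, measurable [set u | block u = k] &
    forall k, exists (B : set T) (t : R), [/\ measurable B,
      forall u, B u -> block u = k, 0 <= t, forall u, B u -> t <= p u &
      ((expR (- (r * t)))%:E < mu B)%E]].
Proof.
move=> ntail.
have [r r0 rP] : exists2 r : R, 0 < r &
    forall N : R, exists2 t, N < t & ((expR (- (r * t)))%:E < D t)%E.
  apply: contrapT => no; apply: ntail => r r0; apply: contrapT => nnear.
  apply: no; exists r => // N; apply: contrapT => no; apply: nnear.
  exists N; split; first exact: num_real.
  move=> t Nt; rewrite leNgt; apply/negP => Dt; apply: no.
  by exists t.
have step (c : nat) : exists m : nat, (c < m)%N /\ exists t : R, [/\ c%:R < t &
    ((expR (- (r * t)))%:E <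
      mu (band t m))%E].
  have [t ct Dt] := rP c%:R; have [m0 m0P] := superlevel_cut Dt.
  exists (maxn m0 c.+1); rewrite leq_maxr; split => //; exists t; split => //.
  by apply: m0P; rewrite leq_maxl.
have [next nextP] := choice step.
pose n k := iter k next 0%N.
have nS k : (n k < n k.+1)%N by have [] := nextP (n k).
have n_ge k : (k <= n k)%N by elim: k => // k ih; exact: leq_ltn_trans (nS k).
have n_homo i j : (i <= j)%N -> (n i <= n j)%N.
  by apply: (homo_leq leqnn leq_trans) => k; exact: ltnW.
have ex u : exists k, p u <= (n k.+1)%:R.
  exists (Num.truncn (p u)); have /andP[_ /ltW pu] := truncn_itv (ltW (p_gt0 u)).
  by rewrite (le_trans pu)// ler_nat.
pose block u := ex_minn (ex u).
have blockP u k : block u = k <-> (n k)%:R < p u <= (n k.+1)%:R.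
  rewrite /block; case: ex_minnP => j pj jmin; split=> [<-|/andP[kp pk]].
    rewrite pj andbT; case: j pj jmin => [|j] _ jmin; first exact: p_gt0.
    by rewrite ltNge; apply/negP => /jmin; rewrite ltnn.
  apply/eqP; rewrite eqn_leq jmin// leqNgt; apply/negP => jk.
  by move: kp; rewrite ltNge (le_trans pj)// ler_nat n_homo.
exists r, block; split => //.
- move=> k; rewrite (_ : [set u | _] =
      [set u | p u <= (n k.+1)%:R] `\` [set u | p u <= (n k)%:R]).
    exact: measurableD.
  apply/seteqP; split=> u /=.
    by move=> /blockP/andP[nu un]; split => //; apply/negP; rewrite -ltNge.
  by move=> [un /negP]; rewrite -ltNge => nu; apply/blockP; rewrite nu.
- move=> k; have [_ [t [kt Bt]]] := nextP (n k).
  exists (band t (n k.+1)), t; split => //.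
  + by apply: measurableI => //; exact: (measurable_superlevel (measurable_exponent p)).
  + move=> u [/=]; rewrite gtr0_norm// => tu un; apply/blockP; rewrite un andbT.
    exact: lt_trans kt tu.
  + by rewrite (le_trans _ (ltW kt)).
  + by move=> u [/=]; rewrite gtr0_norm// => /ltW.
Qed.

Lemma strictly_singular_Lexp0 :
  strictly_singular (inclusion mu p : {linear Linfty mu -> varLp mu p}) ->
  Lexp0 mu p.
Proof.
move=> ss; apply: tail_Lexp0; first exact: measurable_exponent.
apply: contrapT => /not_tail_blocks[r [block [r0 mblock large]]]; apply: ss.
exists (@blockwise_constant _ _ _ mu block); split.
- exact: blockwise_constant_linear.
- exact: blockwise_constant_closed.
- exact: blockwise_constant_infinite large.
- exact: blockwise_constant_isomorphism large.
Qed.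

End strictly_singular_tail.

(** * The equivalence *)

Theorem theorem4p6 (R : realType) (d : measure_display) (T : measurableType d)
    (mu : {finite_measure set T -> \bar R}) (p : exponent T R)
    (mu_atomless : atomless mu) :
  [<-> strictly_singular (inclusion mu p : {linear Linfty mu -> varLp mu p});
       Lexp0 mu p;
       ((\int[lebesgue_measure]_(s in `[0%R, x]) rearrangement mu p s)
          / (x * ln (expR 1 / x))%R%:E)%E @[x --> 0^'+] --> 0%E;
       (fine (mu setT) - x)
         `^ fine (rearrangement mu (fun t => (p t)^-1) x)
         @[x --> within `[0, fine (mu setT)[ (nbhs (fine (mu setT)))]
         --> (0 : R)].
Proof.
have mp := measurable_exponent p.
tfae.
- exact: strictly_singular_Lexp0.
- by move=> pexp; apply: tail_average_rearrangement; exact: (Lexp0_tail mp).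
- move=> avg; apply: tail_powR_rearrangement_inv.
  exact: (average_rearrangement_tail mp avg).
- move=> pow; apply: Lexp0_strictly_singular.
  exact: (tail_Lexp0 mp (powR_rearrangement_inv_tail pow)).
Qed.
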